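(* Let $\Lambda$ be a Noetherian semiperfect ring, let $M \in \mathsf{mod}\,\Lambda$ and assume that $\operatorname{grade} M = n$ (with $n$ a non-negative integer). Then there is an exact sequence of the form $$0 \to \mathrm{Ext}^{n-1}_{\Lambda^{op}}(\mathrm{Ext}^n_\Lambda(M,\Lambda),\Lambda) \to \mathrm{Ext}^1_{\Lambda^{op}}(\mathrm{Tr}\,\Sigma^n\Omega^n M,\Lambda) \to M \xrightarrow{\sigma_n} \mathrm{Ext}^n_{\Lambda^{op}}(\mathrm{Ext}^n_\Lambda(M,\Lambda),\Lambda) \to \mathrm{Ext}^2_{\Lambda^{op}}(\mathrm{Tr}\,\Sigma^n\Omega^n M,\Lambda) \to 0.$$ The following then hold: (i) $\Sigma^n\Omega^n M$ is torsionfree if and only if $\mathrm{Ext}^{n-1}_{\Lambda^{op}}(\mathrm{Ext}^n_\Lambda(M,\Lambda),\Lambda) = 0$ and the morphism $\sigma_n$ is injective. (ii) $\Sigma^n\Omega^n M$ is reflexive if and only if $\mathrm{Ext}^{n-1}_{\Lambda^{op}}(\mathrm{Ext}^n_\Lambda(M,\Lambda),\Lambda) = 0$ and the morphism $\sigma_n$ is bijective.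
   Context: Noetherian means two-sided Noetherian. $\mathsf{mod}\,\Lambda$ is the category of finitely presented right $\Lambda$-modules; left modules are identified with modules over $\Lambda^{op}$. $\operatorname{grade} M := \inf\{ i \geq 0 \mid \mathrm{Ext}^i_\Lambda(M,\Lambda) \neq 0\}$. $\mathrm{Ext}^{-1}$ is zero. The stable category $\underline{\mathsf{mod}}\, \Lambda$ has the objects of $\mathsf{mod}\,\Lambda$, with morphisms taken modulo those factoring through projective objects. The syzygy functor $\Omega$ on $\underline{\mathsf{mod}}\,\Lambda$ is $\Omega M = \ker(P \twoheadrightarrow M)$ for any epimorphism from a projective $P$ in $\mathsf{mod}\,\Lambda$. The Auslander–Bridger transpose $\mathrm{Tr} : \underline{\mathsf{mod}}\,\Lambda \to \underline{\mathsf{mod}}\,\Lambda^{op}$ sends $M$ with presentation $P_1 \to P_0 \to M \to 0$ by finitely generated projectives to $\mathrm{coker}(P_0^* \to P_1^* )$, $(-)^* = \mathrm{Hom}(-,\Lambda)$; it is a contravariant duality, and $\Sigma := \mathrm{Tr}\,\Omega\,\mathrm{Tr}$ on $\underline{\mathsf{mod}}\,\Lambda$. A module $X$ is torsionfree (resp. reflexive) if the canonical evaluation map $X \to X^{**}$ is injective (resp. bijective); these properties are invariant under stable equivalence. *)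

(* Defs.v *)
(* Modules are MathComp left modules.  A right Λ-module, that is a left module
   over Λ^op, is an [lmodType Λ^c], where [Λ^c] is the converse ring; a left
   Λ-module (a right Λ^op-module) is an [lmodType Λ]. *)
From HB Require Import structures.
From mathcomp Require Import all_boot all_order all_algebra.
From mathcomp Require Import generic_quotient ring_quotient.
From mathcomp Require Import boolp.

Set Implicit Arguments.
Unset Strict Implicit.
Unset Printing Implicit Defensive.

Import GRing.Theory.
Local Open Scope ring_scope.

Section Exactness.
Variable A : pzRingType.

Definition exact_at (U V W : lmodType A)
    (f : {linear U -> V}) (g : {linear V -> W}) : Prop :=
  forall v : V, g v = 0 <-> exists u, f u = v.

Definition surj (U V : lmodType A) (f : {linear U -> V}) : Prop :=
  forall v, exists u, f u = v.

Definition is_zero_module (V : lmodType A) : Prop := forall v : V, v = 0.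

Definition short_exact (U V W : lmodType A)
    (f : {linear U -> V}) (g : {linear V -> W}) : Prop :=
  [/\ injective f, exact_at f g & surj g].

Definition right_exact (U V W : lmodType A)
    (f : {linear U -> V}) (g : {linear V -> W}) : Prop :=
  exact_at f g /\ surj g.

Definition projective (P : lmodType A) : Prop :=
  forall (U V : lmodType A) (g : {linear U -> V}) (f : {linear P -> V}),
    surj g -> exists h : {linear P -> U}, g \o h =1 f.

Definition finitely_generated (V : lmodType A) : Prop :=
  exists (n : nat) (f : {linear 'rV[A]_n -> V}), surj f.

Definition finitely_presented (V : lmodType A) : Prop :=
  exists (m n : nat) (g : {linear 'rV[A]_m -> 'rV[A]_n})
    (f : {linear 'rV[A]_n -> V}), right_exact g f.

Definition fg_projective (P : lmodType A) : Prop :=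
  finitely_generated P /\ projective P.

Definition fg_submodule (V : lmodType A) (U : submodClosed V) : Prop :=
  exists (n : nat) (f : {linear 'rV[A]_n -> V}),
    forall v, v \in U <-> exists w, f w = v.

Definition left_noetherian : Prop :=
  forall I : submodClosed (A^o : lmodType A), fg_submodule I.

Definition superfluous (V : lmodType A) (K : V -> Prop) : Prop :=
  forall U : submodClosed V,
    (forall v, exists u k, [/\ u \in U, K k & v = u + k]) ->
    forall v, v \in U.

Definition projective_cover (P V : lmodType A) (p : {linear P -> V}) : Prop :=
  [/\ projective P, surj p & superfluous (fun x => p x = 0)].

Definition all_fg_have_projective_cover : Prop :=
  forall V : lmodType A, finitely_generated V ->
    exists (P : lmodType A) (p : {linear P -> V}), projective_cover p.

Definition factors_through_projective (U V : lmodType A) (f : U -> V) : Prop :=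
  exists (P : lmodType A) (h : {linear U -> P}) (g : {linear P -> V}),
    fg_projective P /\ f =1 g \o h.

(* Isomorphism in the stable category of finitely presented modules. *)
Definition stably_iso (U V : lmodType A) : Prop :=
  exists (f : {linear U -> V}) (g : {linear V -> U}),
    factors_through_projective (fun u => g (f u) - u) /\
    factors_through_projective (fun v => f (g v) - v).

Definition is_syzygy (V K : lmodType A) : Prop :=
  exists (P : lmodType A) (i : {linear K -> P}) (p : {linear P -> V}),
    fg_projective P /\ short_exact i p.

Record proj_resolution (V : lmodType A) := ProjResolution {
  res_obj :> nat -> lmodType A;
  res_diff : forall i, {linear res_obj i.+1 -> res_obj i};
  res_aug : {linear res_obj 0 -> V};
  res_projective : forall i, projective (res_obj i);
  res_aug_exact : right_exact (res_diff 0) res_aug;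
  res_diff_exact : forall i, exact_at (res_diff i.+1) (res_diff i)
}.

End Exactness.

Definition noetherian (L : pzRingType) : Prop :=
  left_noetherian L /\ left_noetherian L^c.

(* Bass' definition, for right modules; the notion is left-right symmetric. *)
Definition semiperfect (L : pzRingType) : Prop :=
  all_fg_have_projective_cover L^c.

Section Kernel.
Variables (A : pzRingType) (U V : lmodType A) (f : {linear U -> V}).

Definition ker_pred : {pred U} := fun u => f u == 0.

Lemma ker_pred_submod : submod_closed ker_pred.
Proof.
split=> [|a u v]; rewrite /in_mem /= /ker_pred ?linear0 // => /eqP fu /eqP fv.
by rewrite linearP fu fv scaler0 addr0.
Qed.

HB.instance Definition _ :=
  GRing.isSubmodClosed.Build A U ker_pred ker_pred_submod.

Record kernel := Kernel { ker_val :> U; _ : ker_val \in ker_pred }.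
HB.instance Definition _ := [isSub for ker_val].
HB.instance Definition _ := [Choice of kernel by <:].
HB.instance Definition _ := [SubChoice_isSubLmodule of kernel by <:].

End Kernel.

Section Quotient.
Variables (A : pzRingType) (V : lmodType A) (S : submodClosed V).
Local Open Scope quotient_scope.

(* [submodClosed] does not record closure under opposite. *)
Definition submod_pred : {pred V} := fun v => v \in S.

Lemma submod_pred_closed : submod_closed submod_pred.
Proof.
split; first exact: (rpred0 S).
by move=> a u v Su Sv; apply: (rpredD (S := S)) => //; apply: (rpredZ (s := S)).
Qed.

HB.instance Definition _ :=
  GRing.isSubmodClosed.Build A V submod_pred submod_pred_closed.

Definition quotient_module := Quotient.quot submod_pred.
HB.instance Definition _ := ZmodQuotient.on quotient_module.
HB.instance Definition _ := GRing.Zmodule.on quotient_module.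

Lemma pi_quotient_add (u v : V) :
  \pi_(quotient_module) (u + v) = \pi u + \pi v :> quotient_module.
Proof. exact: Quotient.pi_add. Qed.

Definition quotient_scale (a : A) (x : quotient_module) : quotient_module :=
  \pi_(quotient_module) (a *: repr x).

Lemma pi_quotient_scale (a : A) (v : V) :
  quotient_scale a (\pi v) = \pi_(quotient_module) (a *: v).
Proof.
apply/eqP; rewrite -Quotient.idealrBE -scalerBr rpredZ //.
by rewrite Quotient.idealrBE reprK.
Qed.

Lemma quotient_scaleA (a b : A) x :
  quotient_scale a (quotient_scale b x) = quotient_scale (a * b) x.
Proof.
elim/quotW: x => v; rewrite (pi_quotient_scale b v).
by rewrite !pi_quotient_scale scalerA.
Qed.

Lemma quotient_scale1 : left_id 1 quotient_scale.
Proof. by elim/quotW => v; rewrite pi_quotient_scale scale1r. Qed.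

Lemma quotient_scaleDr : right_distributive quotient_scale +%R.
Proof.
move=> a; elim/quotW => u; elim/quotW => v.
rewrite !pi_quotient_scale -pi_quotient_add pi_quotient_scale scalerDr.
exact: pi_quotient_add.
Qed.

Lemma quotient_scaleDl x : {morph quotient_scale^~ x : a b / a + b}.
Proof.
move=> a b; elim/quotW: x => v.
by rewrite !pi_quotient_scale scalerDl pi_quotient_add.
Qed.

HB.instance Definition _ := GRing.Zmodule_isLmodule.Build A quotient_module
  quotient_scaleA quotient_scale1 quotient_scaleDr quotient_scaleDl.

End Quotient.

Section Homology.
Variables (A : pzRingType) (U V W : lmodType A).
Variables (f : {linear U -> V}) (g : {linear V -> W}).

Definition boundary : {pred kernel g} :=
  fun z => `[< exists u, f u = ker_val z >].

Lemma boundary_submod : submod_closed boundary.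
Proof.
split=> [|a x y]; rewrite /in_mem /= /boundary.
  by apply/asboolP; exists 0; rewrite linear0.
move=> /asboolP[u fu] /asboolP[v fv]; apply/asboolP.
by exists (a *: u + v); rewrite linearP fu fv.
Qed.

HB.instance Definition _ :=
  GRing.isSubmodClosed.Build A (kernel g) boundary boundary_submod.

(* Ker g / Im f, for a complex U -f-> V -g-> W. *)
Definition homology : lmodType A := quotient_module boundary.

End Homology.
Arguments boundary {A U V W} f g.

(* An additive group with commuting left actions of A and B. *)
Record bimodule (A B : pzRingType) := Bimodule {
  bimod_car :> lmodType A;
  bimod_act : B -> bimod_car -> bimod_car;
  bimod_actA : forall a b x, bimod_act a (bimod_act b x) = bimod_act (a * b) x;
  bimod_act1 : left_id 1 bimod_act;
  bimod_actDr : right_distributive bimod_act +%R;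
  bimod_actDl : forall x, {morph bimod_act^~ x : a b / a + b};
  bimod_actC : forall a b x, bimod_act b (a *: x) = a *: bimod_act b x
}.

Section Flip.
Variables (A B : pzRingType) (D : bimodule A B).

Definition flip_car : Type := D.
HB.instance Definition _ := GRing.Zmodule.on flip_car.
HB.instance Definition _ := GRing.Zmodule_isLmodule.Build B flip_car
  (@bimod_actA _ _ D) (@bimod_act1 _ _ D)
  (@bimod_actDr _ _ D) (@bimod_actDl _ _ D).

Definition flip : bimodule B A := @Bimodule B A flip_car
  (fun a (x : D) => a *: x) (@scalerA _ D) (@scale1r _ D) (@scalerDr _ D)
  (@scalerDl _ D) (fun b a x => esym (@bimod_actC _ _ D a b x)).

End Flip.

Section RegularBimodule.
Variable L : pzRingType.

Definition regular_act (b : L) (x : (L^c)^o) : (L^c)^o := (b * (x : L) : L).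

Lemma regular_actC (a : L^c) (b : L) (x : (L^c)^o) :
  regular_act b (a *: x) = a *: regular_act b x.
Proof. exact: (mulrA b (x : L) (a : L)). Qed.

(* The ring L as a right module over itself, so that duals and Ext of right
   modules are left modules. *)
Definition right_regular : bimodule L^c L :=
  @Bimodule L^c L ((L^c)^o : lmodType L^c) regular_act
    (@mulrA L) (@mul1r L) (@mulrDr L)
    (fun x a b => @mulrDl L a b x) regular_actC.

(* The ring L as a left module over itself. *)
Definition left_regular : bimodule L L^c := flip right_regular.

End RegularBimodule.

Section Dual.
Variables (A B : pzRingType) (D : bimodule A B) (X : lmodType A).

Definition dual : Type := {linear X -> D}.
HB.instance Definition _ := gen_eqMixin dual.
HB.instance Definition _ := gen_choiceMixin dual.

Lemma dual_ext (f g : dual) : (f : {linear X -> D}) =1 (g : {linear X -> D}) -> f = g.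
Proof.
case: f g => [f [[f1] [f2]]] [g [[g1] [g2]]] /= /funext fg.
rewrite fg in f1 f2 *.
by rewrite (Prop_irrelevance f1 g1) (Prop_irrelevance f2 g2).
Qed.

Definition dual_scale_fun (b : B) (f : {linear X -> D}) (x : X) : D :=
  bimod_act b (f x).

Lemma dual_scale_linear b f : linear (dual_scale_fun b f).
Proof.
by move=> a x y; rewrite /dual_scale_fun linearP bimod_actDr bimod_actC.
Qed.

HB.instance Definition _ b f := GRing.isLinear.Build A X D *:%R
  (dual_scale_fun b f) (dual_scale_linear b f).

Definition dual_zero : dual := (\0 : {linear X -> D}).
Definition dual_add (f g : dual) : dual :=
  ((f : {linear X -> D}) \+ (g : {linear X -> D}) : {linear X -> D}).
Definition dual_opp (f : dual) : dual :=
  (\- (f : {linear X -> D}) : {linear X -> D}).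
Definition dual_scale (b : B) (f : dual) : dual :=
  (dual_scale_fun b f : {linear X -> D}).

Lemma dual_addA : associative dual_add.
Proof. by move=> f g h; apply: dual_ext => x /=; rewrite addrA. Qed.
Lemma dual_addC : commutative dual_add.
Proof. by move=> f g; apply: dual_ext => x /=; rewrite addrC. Qed.
Lemma dual_add0 : left_id dual_zero dual_add.
Proof. by move=> f; apply: dual_ext => x /=; rewrite add0r. Qed.
Lemma dual_addN : left_inverse dual_zero dual_opp dual_add.
Proof. by move=> f; apply: dual_ext => x /=; rewrite addNr. Qed.

HB.instance Definition _ := GRing.isZmodule.Build dual
  dual_addA dual_addC dual_add0 dual_addN.

Lemma dual_scaleA a b f : dual_scale a (dual_scale b f) = dual_scale (a * b) f.
Proof. by apply: dual_ext => x; exact: bimod_actA. Qed.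
Lemma dual_scale1 : left_id 1 dual_scale.
Proof. by move=> f; apply: dual_ext => x; exact: bimod_act1. Qed.
Lemma dual_scaleDr : right_distributive dual_scale +%R.
Proof. by move=> a f g; apply: dual_ext => x; exact: bimod_actDr. Qed.
Lemma dual_scaleDl f : {morph dual_scale^~ f : a b / a + b}.
Proof. by move=> a b; apply: dual_ext => x; exact: bimod_actDl. Qed.

HB.instance Definition _ := GRing.Zmodule_isLmodule.Build B dual
  dual_scaleA dual_scale1 dual_scaleDr dual_scaleDl.

Definition dual_eval (f : dual) (x : X) : D := (f : {linear X -> D}) x.

End Dual.

Section DualMap.
Variables (A B : pzRingType) (D : bimodule A B) (X Y : lmodType A).
Variable u : {linear X -> Y}.

Definition dual_map (f : dual D Y) : dual D X :=
  ((f : {linear Y -> D}) \o u : {linear X -> D}).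

Lemma dual_map_linear : linear dual_map.
Proof. by move=> b f g; apply: dual_ext. Qed.

HB.instance Definition _ := GRing.isLinear.Build B (dual D Y) (dual D X) *:%R
  dual_map dual_map_linear.

End DualMap.
Arguments dual_map {A B} D {X Y} u f.

Section Bidual.
Variables (A B : pzRingType) (D : bimodule A B) (X : lmodType A).

Definition bidual_fun (x : X) (f : dual D X) : flip D := dual_eval f x.

Lemma bidual_fun_linear x : linear (bidual_fun x).
Proof. by []. Qed.

HB.instance Definition _ x := GRing.isLinear.Build B (dual D X) (flip D) *:%R
  (bidual_fun x) (bidual_fun_linear x).

(* The canonical map X -> X^**. *)
Definition bidual_map (x : X) : dual (flip D) (dual D X) :=
  (bidual_fun x : {linear dual D X -> flip D}).

Definition torsionfree : Prop := injective bidual_map.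
Definition reflexive_module : Prop := bijective bidual_map.

End Bidual.

Section Ext.
Variables (A B : pzRingType) (D : bimodule A B) (X : lmodType A).
Variable P : proj_resolution X.

(* The complex Hom(P, D), shifted by one so as to begin with a zero term:
   0 -> Hom(P_0, D) -> Hom(P_1, D) -> ... *)
Definition cochain (n : nat) : lmodType B :=
  if n is m.+1 then dual D (P m) else 'rV[B]_0.

Definition codiff (n : nat) : {linear cochain n -> cochain n.+1} :=
  match n with
  | 0 => \0
  | m.+1 => dual_map D (res_diff P m)
  end.

(* Ext^n_A(X, D), a B-module. *)
Definition Ext (n : nat) : lmodType B := homology (codiff n) (codiff n.+1).

(* Ext^(n-1)_A(X, D), with Ext^(-1) = 0. *)
Definition Ext_pred (n : nat) : lmodType B :=
  if n is m.+1 then Ext m else 'rV[B]_0.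

(* n = inf { i | Ext^i_A(X, D) <> 0 }; the grade of X if D is the ring. *)
Definition grade_eq (n : nat) : Prop :=
  ~ is_zero_module (Ext n) /\ forall i, ~ is_zero_module (Ext i) -> (n <= i)%N.

End Ext.

(* Cokernel of P_0^* -> P_1^*, for a presentation P_1 -> P_0 -> X -> 0. *)
Definition is_transpose (A B : pzRingType) (D : bimodule A B)
    (X : lmodType A) (T : lmodType B) : Prop :=
  exists (P1 P0 : lmodType A) (d : {linear P1 -> P0}) (e : {linear P0 -> X})
    (q : {linear dual D P1 -> T}),
    [/\ fg_projective P1, fg_projective P0,
        right_exact d e & right_exact (dual_map D d) q].

Definition is_sigma (A B : pzRingType) (D : bimodule A B)
    (X Y : lmodType A) : Prop :=
  exists T K : lmodType B,
    [/\ is_transpose D X T, is_syzygy T K & is_transpose (flip D) K Y].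

Fixpoint iter_rel (T : Type) (r : T -> T -> Prop) (n : nat) (x y : T) : Prop :=
  if n is m.+1 then exists2 z, iter_rel r m x z & r z y else x = y.

(* Y represents Sigma^n Omega^n X: syzygies and transposes depend on choices of
   projective presentations, and are defined only in the stable category. *)
Definition is_sigma_omega (A B : pzRingType) (D : bimodule A B) (n : nat)
    (X Y : lmodType A) : Prop :=
  exists K Z : lmodType A,
    [/\ iter_rel (@is_syzygy A) n X K, iter_rel (is_sigma D) n K Z
      & stably_iso Z Y].

(* Main.v *)
(* Let E = Ext^n(M, L), let P be a resolution of M by finitely generated
   projectives and let N be the cokernel of P_n^* -> P_(n+1)^*, so that N is a
   transpose of Omega^n M.  Since Ext^i(M, L) = 0 for i < n, the complex
   P_0^* -> ... -> P_n^* resolves the cokernel C of its last map, and E embeds in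
   C as the kernel of C -> P_(n+1)^*.  Hence, for a resolution Q of E, the cone of
   a lift of E -> C extended by P_(n+1)^* is a resolution R of N.  Finitely
   generated projectives are reflexive, so the long exact sequence obtained by
   dualising the cone computes M as the cokernel of P_1^** -> P_0^**, and reads
     0 -> Ext^(n-1)(E) -> Ext^(n+1)(N) -> M -> Ext^n(E) -> Ext^(n+2)(N) -> 0.
   Finally Tr Sigma^n Omega^n M is stably isomorphic to Omega^n N, so that its
   Ext^1 and Ext^2 are Ext^(n+1)(N) and Ext^(n+2)(N).  The case n = 0, applied to
   X = Sigma^n Omega^n M, identifies Ext^1(Tr X) and Ext^2(Tr X) with the kernel
   and the cokernel of X -> X^**, which gives (i) and (ii). *)
Require Import Defs.
From HB Require Import structures.
From mathcomp Require Import all_boot all_order all_algebra.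
From mathcomp Require Import generic_quotient ring_quotient.
From mathcomp Require Import boolp.

Set Implicit Arguments.
Unset Strict Implicit.
Unset Printing Implicit Defensive.

Import GRing.Theory.
Local Open Scope ring_scope.

(** * Linear maps, projective modules and homology classes *)

Section LinearMaps.
Variable A : pzRingType.
Implicit Types U V W X P Q : lmodType A.

(** The resolutions [P], [Q] and [Res] of the statement are arbitrary, and [X] and [T] are fixed
    only up to choices. The construction needs finitely generated projectives, whose evaluation maps
    are bijective; it is therefore run on auxiliary resolutions, and Ext is transported afterwards,
    using that Ext in positive degree depends only on the stable class. The Ext groups involved are
    quotients attached to different complexes; a map between them is given as a linear relation
    between cycles and classes, and well-definedness reduces to a check at zero. The two sides of
    the ring enter through an abstract pair of bimodules, so that each fact on duals and transposes
    serves both sides. No long exact sequence in all degrees is built: only five terms matter, and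
    at that end the dual of the cone is short enough for one diagram chase. The chase also records
    sigma on representatives; without this the case n = 0 would yield a map X -> Ext^0(Ext^0(X))
    with no visible link to evaluation. *)

Lemma linear_of_fun U V (k : U -> V) :
  linear k -> exists f : {linear U -> V}, f =1 k.
Proof.
move=> kL; pose m := GRing.isLinear.Build A U V *:%R k kL.
by exists (HB.pack k m : {linear U -> V}).
Qed.

(** Subtracting two values at the same point shows that a linear relation is single-valued as soon
    as it is so at 0. Maps on homology are defined this way. *)
Lemma linear_of_rel U V (r : U -> V -> Prop) :
  (forall a u v u' v', r u v -> r u' v' -> r (a *: u + u') (a *: v + v')) ->
  (forall u, exists v, r u v) -> (forall v, r 0 v -> v = 0) ->
  exists f : {linear U -> V}, forall u v, r u v <-> f u = v.
Proof.
move=> rL rT r0.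
have rF u v v' : r u v -> r u v' -> v = v'.
  move=> /(rL (-1)) h /h; rewrite !scaleN1r addNr => /r0 /eqP.
  by rewrite addrC subr_eq0 => /eqP.
pose k u := sval (cid (rT u)).
have kP u : r u (k u) by rewrite /k; case: cid.
have kL : linear k by move=> a u v; apply: rF (kP _) _; apply: rL.
have [f fE] := linear_of_fun kL; exists f => u v; rewrite fE.
by split=> [/(rF _ _ _ (kP u))|<-].
Qed.

Definition ker_inc U V (f : {linear U -> V}) : {linear kernel f -> U} := \val.

Lemma ker_inc_inj U V (f : {linear U -> V}) : injective (ker_inc f).
Proof. exact: val_inj. Qed.

Lemma ker_incP U V (f : {linear U -> V}) u :
  f u = 0 <-> exists k, ker_inc f k = u.
Proof.
split=> [fu|[[k kP] <-]]; last exact: (eqP kP).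
have kP : u \in ker_pred f by apply/eqP.
by exists (Kernel kP).
Qed.

Lemma factor_inj U V W (i : {linear U -> V}) (f : {linear W -> V}) :
  injective i -> (forall w, exists u, i u = f w) ->
  exists g : {linear W -> U}, forall w, i (g w) = f w.
Proof.
move=> iI h; have [||v|g gE] := @linear_of_rel W U (fun w u => i u = f w).
- by move=> a w u w' u' e e'; rewrite !linearP e e'.
- exact: h.
- by rewrite linear0 -{1}(linear0 i) => /iI.
- by exists g => w; apply/gE.
Qed.

Lemma factor_surj U V W (p : {linear U -> V}) (f : {linear U -> W}) :
  surj p -> (forall u, p u = 0 -> f u = 0) ->
  exists g : {linear V -> W}, forall u, g (p u) = f u.
Proof.
move=> pS h.
have [|||g gE] :=
    @linear_of_rel V W (fun v w => exists2 u, p u = v & f u = w).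
- move=> a v w v' w' [u <- <-] [u' <- <-].
  by exists (a *: u + u'); rewrite linearP.
- by move=> v; have [u <-] := pS v; exists (f u), u.
- by move=> w [u /h -> <-].
- by exists g => u; apply/gE; exists u.
Qed.

Lemma linear_inj U V (f : {linear U -> V}) :
  (forall u, f u = 0 -> u = 0) -> injective f.
Proof.
by move=> h u v e; apply/eqP; rewrite -subr_eq0; apply/eqP/h;
  rewrite linearB e subrr.
Qed.

Lemma inj_surj_bij U V (f : {linear U -> V}) :
  injective f -> surj f -> bijective f.
Proof.
move=> fI fS; exists (fun v => sval (cid (fS v))) => x; last by case: cid.
by apply: fI; case: cid.
Qed.

Definition miso U V : Prop :=
  exists (f : {linear U -> V}) (g : {linear V -> U}), cancel f g /\ cancel g f.

Lemma miso_sym U V : miso U V -> miso V U.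
Proof. by move=> [f [g [fg gf]]]; exists g, f. Qed.

Lemma miso_trans U V W : miso U V -> miso V W -> miso U W.
Proof.
move=> [f [g [fg gf]]] [f' [g' [fg' gf']]].
by exists (f' \o f), (g \o g'); split=> x /=; rewrite ?fg' ?fg ?gf ?gf'.
Qed.

Lemma miso_zero U V : miso U V -> is_zero_module U -> is_zero_module V.
Proof. by move=> [f [g [_ gf]]] U0 v; rewrite -(gf v) (U0 (g v)) linear0. Qed.

Lemma zero_rV0 : is_zero_module ('rV[A]_0).
Proof. by move=> v; apply/rowP; case. Qed.

Lemma linear_row n V (x : 'I_n -> V) : linear (fun w : 'rV[A]_n => \sum_i w 0 i *: x i).
Proof.
move=> a v w; rewrite scaler_sumr -big_split; apply: eq_bigr => i _ /=.
by rewrite !mxE scalerDl scalerA.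
Qed.

Lemma rV_ext n V (f g : {linear 'rV[A]_n -> V}) :
  (forall i, f (delta_mx 0 i) = g (delta_mx 0 i)) -> f =1 g.
Proof.
move=> h v; rewrite (row_sum_delta v) !linear_sum.
by apply: eq_bigr => i _; rewrite !linearZ /= h.
Qed.

Lemma linear_rV n V (x : 'I_n -> V) : exists f : {linear 'rV[A]_n -> V},
  (forall i, f (delta_mx 0 i) = x i) /\ (forall w, f w = \sum_i w 0 i *: x i).
Proof.
have [f fE] := linear_of_fun (linear_row x); exists f; split=> // i.
rewrite fE (bigD1 i) //= big1 => [|j ji]; rewrite mxE !eqxx /=.
  by rewrite scale1r addr0.
by rewrite (negPf ji) scale0r.
Qed.

Lemma projective_rV n : projective ('rV[A]_n).
Proof.
move=> U V g f gS.
pose x i := sval (cid (gS (f (delta_mx 0 i)))).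
have [h [hE _]] := linear_rV x; exists h.
by apply: (rV_ext (f := g \o h)) => i /=; rewrite hE /x; case: cid.
Qed.

Lemma linear_pair U V W (f : {linear U -> W}) (g : {linear V -> W}) :
  exists h : {linear (U * V)%type -> W}, forall x, h x = f x.1 + g x.2.
Proof.
apply: linear_of_fun => a x y /=.
by rewrite !linearP scalerDr addrACA.
Qed.

Lemma linear_topair U V W (f : {linear W -> U}) (g : {linear W -> V}) :
  exists h : {linear W -> (U * V)%type}, forall x, h x = (f x, g x).
Proof. by apply: linear_of_fun => a x y /=; rewrite !linearP. Qed.

(** Only the image of [a] has to lie in that of [f]. The kernel of (u, x) |-> f u - a x is the
    pullback; its projection to [P] is surjective, and a splitting of that projection yields [b]. *)
Lemma projective_lift P U V (f : {linear U -> V}) (a : {linear P -> V}) :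
  projective P -> (forall x, exists u, f u = a x) ->
  exists b : {linear P -> U}, forall x, f (b x) = a x.
Proof.
move=> Pp fa; have [h hE] := linear_pair f (\- a).
have [p1 p1E] := @linear_of_fun (U * P)%type U fst (fun _ _ _ => erefl).
have [p2 p2E] := @linear_of_fun (U * P)%type P snd (fun _ _ _ => erefl).
have [x|b bE] := Pp _ _ (p2 \o ker_inc h) idfun.
  have [u uE] := fa x.
  have [|k kE] := (ker_incP h (u, x)).1; first by rewrite hE /= uE subrr.
  by exists k; rewrite -[LHS]/(p2 (ker_inc h k)) kE p2E.
exists (p1 \o (ker_inc h \o b)) => x /=; apply/eqP; rewrite -subr_eq0; apply/eqP.
have := (ker_incP h _).2 (ex_intro _ (b x) erefl).
by rewrite hE /= p1E -p2E -[p2 _]/((p2 \o ker_inc h \o b) x) bE.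
Qed.

Lemma projective_pair P Q :
  projective P -> projective Q -> projective (P * Q)%type.
Proof.
move=> Pp Qp U V g f gS.
have [i1 i1E] := linear_topair (@idfun P) (\0 : {linear P -> Q}).
have [i2 i2E] := linear_topair (\0 : {linear Q -> P}) (@idfun Q).
have [a aE] := Pp _ _ g (f \o i1) gS.
have [b bE] := Qp _ _ g (f \o i2) gS.
have [h hE] := linear_pair a b; exists h => -[x y] /=.
rewrite hE linearD /= [g (a x)]aE [g (b y)]bE /= i1E i2E -linearD /=.
by congr (f _); congr (_, _); rewrite ?addr0 ?add0r.
Qed.

Lemma fg_pair P Q :
  finitely_generated P -> finitely_generated Q -> finitely_generated (P * Q)%type.
Proof.
move=> [m [f fS]] [n [g gS]]; exists (m + n)%N.
have [h hE] := linear_topair (f \o lsubmx) (g \o rsubmx).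
exists h => -[x y]; have [v vE] := fS x; have [w wE] := gS y.
by exists (row_mx v w); rewrite hE /= row_mxKl row_mxKr vE wE.
Qed.

Lemma fg_projective_rV n : fg_projective ('rV[A]_n).
Proof. by split; [exists n, idfun => v; exists v|exact: projective_rV]. Qed.

Lemma fg_projective_pair P Q :
  fg_projective P -> fg_projective Q -> fg_projective (P * Q)%type.
Proof. by move=> [? ?] [? ?]; split; [apply: fg_pair|apply: projective_pair]. Qed.

End LinearMaps.

Section HomologyClasses.
Variables (A : pzRingType) (U V W : lmodType A).
Variables (f : {linear U -> V}) (g : {linear V -> W}).
Local Open Scope quotient_scope.

(* [rep v h]: the cycle [v] represents the class [h].  Working with this relation
   instead of the quotient lets homology be transported along isomorphic
   complexes. *)
Record is_homology (H : lmodType A) (rep : V -> H -> Prop) : Prop := IsHomology {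
  rep_linear : forall a v h v' h',
    rep v h -> rep v' h' -> rep (a *: v + v') (a *: h + h');
  rep_total : forall v, g v = 0 -> exists h, rep v h;
  rep_cycle : forall v h, rep v h -> g v = 0;
  rep_surj : forall h, exists v, rep v h;
  rep0P : forall v h, rep v h -> (h = 0 <-> exists u, f u = v) }.

Definition hrep (v : V) (h : homology f g) : Prop :=
  exists2 z : kernel g, ker_inc g z = v & \pi_(quotient_module (boundary f g)) z = h.

Lemma hrepP : is_homology hrep.
Proof.
split.
- move=> a v h v' h' [z <- <-] [z' <- <-]; exists (a *: z + z').
    by rewrite linearP.
  by rewrite pi_quotient_add -pi_quotient_scale.
- by move=> v /ker_incP[z <-]; exists (\pi z), z.
- by move=> v h [z <- _]; apply/ker_incP; exists z.
- by elim/quotW => z; exists (ker_inc g z), z.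
- move=> v h [z <- <-].
  have -> : (\pi z = 0 :> quotient_module (boundary f g)) <->
      z \in submod_pred (boundary f g).
    rewrite -[X in X \in _]subr0 Quotient.idealrBE.
    have -> : 0 = \pi_(quotient_module (boundary f g)) 0 by rewrite [RHS]raddf0.
    by split=> /eqP.
  by split=> /asboolP.
Qed.

Lemma rep_eq (H : lmodType A) (rep : V -> H -> Prop) v v' h h' : is_homology rep ->
  rep v h -> rep v' h' -> (exists u, f u = v - v') -> h = h'.
Proof.
move=> hP vh vh' e.
apply/eqP; rewrite -subr_eq0 addrC -scaleN1r; apply/eqP.
have r := rep_linear hP (-1) vh' vh; apply/(rep0P hP r).
by rewrite scaleN1r addrC.
Qed.

Lemma homology_class : exists c : {linear kernel g -> homology f g},
  forall z h, hrep (ker_inc g z) h <-> c z = h.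
Proof.
apply: linear_of_rel => [a z h z' h' zh zh'|z|h /(rep0P hrepP) ->].
- by rewrite linearP; apply: (rep_linear hrepP).
- by apply: (rep_total hrepP); apply/ker_incP; exists z.
- by exists 0; rewrite !linear0.
Qed.

Lemma homology_class_surj (c : {linear kernel g -> homology f g}) :
  (forall z h, hrep (ker_inc g z) h <-> c z = h) -> surj c.
Proof.
move=> cE h; have [v vh] := rep_surj hrepP h.
have [z zE] := (ker_incP g v).1 (rep_cycle hrepP vh).
by exists z; apply/cE; rewrite zE.
Qed.

End HomologyClasses.

(** The homology of U -> V -> 0 is the cokernel of [f]. *)
Lemma cokernel_exists (A : pzRingType) (U V : lmodType A) (f : {linear U -> V}) :
  exists (W : lmodType A) (q : {linear V -> W}), right_exact f q.
Proof.
pose g : {linear V -> 'rV[A]_0} := \0.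
have H := hrepP f g; exists (homology f g).
have [|||q qE] := @linear_of_rel _ V (homology f g) (fun v h => hrep v h).
- exact: rep_linear H.
- by move=> v; apply: (rep_total H).
- by move=> h /(rep0P H) ->; exists 0; rewrite linear0.
exists q; split=> [v|h]; last by have [v /qE] := rep_surj H h; exists v.
have r : hrep v (q v) by apply/qE.
exact: (rep0P H r).
Qed.

(** * Finitely generated resolutions over Noetherian rings *)

Section Noetherian.
Variable A : pzRingType.
Implicit Types U V W X P Q : lmodType A.

Definition linear_set V (S : V -> Prop) : Prop :=
  S 0 /\ forall a u v, S u -> S v -> S (a *: u + v).

(** Submodules are bare predicates here, so that images and preimages under linear maps qualify
    without packaging. *)
Definition noetherian_module V : Prop :=
  forall S : V -> Prop, linear_set S ->
    exists n (f : {linear 'rV[A]_n -> V}), forall v, S v <-> exists w, f w = v.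

Lemma noetherian_regular : left_noetherian A -> noetherian_module (A^o : lmodType A).
Proof.
move=> noeA S [S0 SL].
pose p : {pred (A^o : lmodType A)} := fun v => `[< S v >].
have pL : submod_closed p.
  split=> [|a u v]; rewrite /in_mem /=; first exact/asboolP.
  by move=> /asboolP Su /asboolP Sv; apply/asboolP/SL.
pose m := GRing.isSubmodClosed.Build A (A^o : lmodType A) p pL.
have [n [f fE]] := noeA (HB.pack p m : submodClosed (A^o : lmodType A)).
exists n, f => v; rewrite -fE; split=> h; first exact/asboolP.
exact: (asboolP _ h).
Qed.

Lemma linear_set_sum V (S : V -> Prop) n (c : 'I_n -> A) (x : 'I_n -> V) :
  linear_set S -> (forall i, S (x i)) -> S (\sum_i c i *: x i).
Proof.
move=> [S0 SL] Sx; apply: (big_rec S) => // i v _ Sv.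
exact: SL.
Qed.

(** A submodule of [V] is generated by the images of generators of its preimage in [U] and by lifts
    of generators of its image in [W]. With W = 0 this covers quotients. *)
Lemma noetherian_ext U V W (f : {linear U -> V}) (g : {linear V -> W}) :
  exact_at f g -> noetherian_module U -> noetherian_module W ->
  noetherian_module V.
Proof.
move=> fg noeU noeW S [S0 SL].
have [|m [c cE]] := noeU (fun u => S (f u)).
  by split=> [|a u v]; rewrite ?linear0 // linearP; apply: SL.
have [|n [b bE]] := noeW (fun w => exists2 s, S s & g s = w).
  split=> [|a u v [s Ss <-] [t St <-]]; first by exists 0; rewrite ?linear0.
  by exists (a *: s + t); [apply: SL|rewrite linearP].
have bx i : exists s, S s /\ g s = b (delta_mx 0 i).
  by have [|s] := (bE (b (delta_mx 0 i))).2; [exists (delta_mx 0 i)|exists s].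
pose x i := sval (cid (bx i)).
have [Sx gx] : (forall i, S (x i)) /\ (forall i, g (x i) = b (delta_mx 0 i)).
  by split=> i; rewrite /x; case: cid => ? [].
have [d [dx dE]] := linear_rV x.
have gd : g \o d =1 b by apply: (rV_ext (f := g \o d)) => i /=; rewrite dx gx.
have Sd w : S (d w) by rewrite dE; apply: linear_set_sum.
exists (m + n)%N, ((f \o (c \o lsubmx)) \+ (d \o rsubmx)) => v; split=> [Sv|[w <-]] /=.
  have [|w wE] := (bE (g v)).1; first by exists v.
  have [|u uE] := (fg (v - d w)).1.
    by rewrite linearB -wE -[g (d w)]/((g \o d) w) gd subrr.
  have [|w' w'E] := (cE u).1.
    by rewrite uE addrC -scaleN1r; apply: SL.
  by exists (row_mx w' w); rewrite row_mxKl row_mxKr w'E uE subrK.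
rewrite -[f _]scale1r; apply: SL => //.
by apply/cE; exists (lsubmx w).
Qed.

Lemma noetherian_zero V : is_zero_module V -> noetherian_module V.
Proof.
move=> V0 S [S0 _]; exists 0%N, \0 => v; rewrite (V0 v).
by split=> // _; exists 0.
Qed.

Hypothesis noeA : left_noetherian A.

Lemma noetherian_rV n : noetherian_module ('rV[A]_n).
Proof.
elim: n => [|n IHn]; first exact: noetherian_zero (@zero_rV0 A).
have [|g gE] := @linear_of_fun A ('rV[A]_n.+1) (A^o : lmodType A) (fun v => v 0 0).
  by move=> a u v; rewrite !mxE.
have [|f fE] := @linear_of_fun A ('rV[A]_n) ('rV[A]_(1 + n)) (row_mx 0).
  by move=> a u v; rewrite scale_row_mx add_row_mx scaler0 addr0.
apply: (@noetherian_ext _ _ _ f g) => //; last exact: noetherian_regular.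
move=> v; rewrite gE; split=> [v0|[u <-]].
  exists (rsubmx (v : 'rV_(1 + n))); rewrite fE.
  rewrite -[RHS](@hsubmxK _ 1 1 n v); congr row_mx.
  apply/rowP => i; rewrite !mxE (ord1 i) -v0; congr (v _ _); exact: val_inj.
by rewrite fE mxE; case: splitP => [j _|k //]; rewrite mxE.
Qed.

Lemma noetherian_fg V : finitely_generated V -> noetherian_module V.
Proof.
move=> [n [f fS]].
apply: (@noetherian_ext _ _ _ f (\0 : {linear V -> 'rV[A]_0})).
- by move=> v; split.
- exact: noetherian_rV.
- exact: noetherian_zero (@zero_rV0 A).
Qed.

Lemma fg_inj U V (f : {linear U -> V}) :
  injective f -> finitely_generated V -> finitely_generated U.
Proof.
move=> fI /noetherian_fg /(_ (fun v => exists u, f u = v)) [|n [b bE]].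
  split=> [|a _ _ [u <-] [v <-]]; first by exists 0; rewrite linear0.
  by exists (a *: u + v); rewrite linearP.
have [w|c cE] := factor_inj (f := b) fI; first by apply/bE; exists w.
exists n, c => u; have [|w wE] := (bE (f u)).1; first by exists u.
by exists w; apply: fI; rewrite cE.
Qed.

Lemma fg_surj U V (f : {linear U -> V}) :
  surj f -> finitely_generated U -> finitely_generated V.
Proof.
move=> fS [n [g gS]]; exists n, (f \o g) => v.
by have [u <-] := fS v; have [w <-] := gS u; exists w.
Qed.

Definition fg_resolution V (S : proj_resolution V) : Prop :=
  forall i, fg_projective (S i).

(** Bundled so that taking a syzygy is an endofunction, whose iterates give the resolution. *)
Definition fg_module := {V : lmodType A | finitely_generated V}.

Lemma fg_cover (V : fg_module) :
  {nf : {n & {linear 'rV[A]_n -> sval V}} | surj (projT2 nf)}.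
Proof.
by apply: cid; case: V => V [n [f fS]]; exists (existT _ n f).
Qed.

Definition fg_syzygy (V : fg_module) : fg_module :=
  exist _ (kernel (projT2 (sval (fg_cover V))) : lmodType A)
    (fg_inj (@ker_inc_inj _ _ _ _) (fg_projective_rV A _).1).

Lemma fg_resolution_exists V :
  finitely_generated V -> exists S : proj_resolution V, fg_resolution S.
Proof.
move=> Vfg; pose W i := iter i fg_syzygy (exist _ V Vfg : fg_module).
pose n i := projT1 (sval (fg_cover (W i))).
pose f i : {linear 'rV[A]_(n i) -> sval (W i)} := projT2 (sval (fg_cover (W i))).
have fS i : surj (f i) by exact: (svalP (fg_cover (W i))).
pose inc i : {linear sval (W i.+1) -> 'rV[A]_(n i)} := ker_inc (f i).
pose d i : {linear 'rV[A]_(n i.+1) -> 'rV[A]_(n i)} := inc i \o f i.+1.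
have incP i v : f i v = 0 <-> exists u, d i u = v.
  rewrite ker_incP; split=> [[k <-]|[u <-]]; last by exists (f i.+1 u).
  by have [u <-] := fS i.+1 k; exists u.
unshelve eexists (@ProjResolution A V (fun i => 'rV[A]_(n i)) d (f 0%N) _ _ _).
- by move=> i; apply: projective_rV.
- by split; [apply: incP|apply: fS].
- move=> i v; rewrite -incP; split=> [|e]; last first.
    by rewrite -(linear0 (inc i)) -e.
  by rewrite -{1}(linear0 (inc i)) => /ker_inc_inj.
- by move=> i; apply: fg_projective_rV.
Qed.

End Noetherian.

(** * Syzygies read off a resolution *)

Section Syzygies.
Variables (A : pzRingType) (V : lmodType A) (S : proj_resolution V).

Definition aug_obj (n : nat) : lmodType A := if n is m.+1 then S m else V.

Definition aug_diff (n : nat) : {linear S n -> aug_obj n} :=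
  match n with 0 => res_aug S | m.+1 => res_diff S m end.

Definition syzygy_of (n : nat) : lmodType A :=
  if n is m.+1 then kernel (aug_diff m) else V.

Lemma aug_diff_exact n : exact_at (res_diff S n) (aug_diff n).
Proof. by case: n => [|n]; [case: (res_aug_exact S)|apply: res_diff_exact]. Qed.

Lemma syzygy_cover n : exists2 a : {linear S n -> syzygy_of n}, surj a &
  forall x, a x = 0 <-> aug_diff n x = 0.
Proof.
case: n => [|n]; first by exists (res_aug S) => //; case: (res_aug_exact S).
have [x|a aE] := factor_inj (f := res_diff S n) (@ker_inc_inj _ _ _ (aug_diff n)).
  by apply/ker_incP/aug_diff_exact; exists x.
exists a => [k|x] /=.
  have /aug_diff_exact[x xE] := (ker_incP (aug_diff n) _).2 (ex_intro _ k erefl).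
  by exists x; apply: ker_inc_inj; rewrite aE.
rewrite -aE; split=> [->|]; rewrite ?linear0 //.
by rewrite -{1}(linear0 (ker_inc (aug_diff n))) => /ker_inc_inj.
Qed.

Lemma syzygy_presentation n :
  exists a : {linear S n -> syzygy_of n}, right_exact (res_diff S n) a.
Proof.
have [a aS aE] := syzygy_cover n; exists a; split=> // x.
by rewrite aE aug_diff_exact.
Qed.

Lemma syzygy_step n : fg_resolution S -> is_syzygy (syzygy_of n) (syzygy_of n.+1).
Proof.
move=> Sfg; have [a aS aE] := syzygy_cover n.
exists (S n), (ker_inc (aug_diff n)), a; split=> //; split=> //.
  exact: ker_inc_inj.
by move=> x; rewrite aE ker_incP.
Qed.

Lemma syzygy_iter n : fg_resolution S -> iter_rel (@is_syzygy A) n V (syzygy_of n).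
Proof.
move=> Sfg; elim: n => //= n IHn.
by exists (syzygy_of n) => //; apply: syzygy_step.
Qed.

(** The truncation of [S] at n resolves the n-th syzygy. Writing its terms as [S (i + n)] makes
    [i.+1 + n] reduce, and Ext in positive degree does not mention the augmentation, so both
    equalities hold by conversion. *)
Lemma Ext_shift (B : pzRingType) (D : bimodule A B) n :
  exists S' : proj_resolution (syzygy_of n),
    Ext D S' 1 = Ext D S n.+1 /\ Ext D S' 2 = Ext D S n.+2.
Proof.
have [a aE] := syzygy_presentation n.
unshelve eexists (@ProjResolution A (syzygy_of n) (fun i => S (i + n)%N)
  (fun i => res_diff S (i + n)%N) a _ _ _) => //.
- by move=> i; apply: res_projective.
- exact (fun i => @res_diff_exact _ _ S (i + n)%N).
Qed.

End Syzygies.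

(** * Comparison of resolutions and stable equivalence *)

Section Comparison.
Variable A : pzRingType.

(** The bottom map is prescribed and the target is exact only above degree 0, so that the lemma
    applies to the dual complex of a resolution as well. The recursion carries two consecutive
    components, since the square between them is what permits the next lift. *)
Lemma lift_chain (P C : nat -> lmodType A)
    (dP : forall i, {linear P i.+1 -> P i}) (dC : forall i, {linear C i.+1 -> C i})
    (a0 : {linear P 0 -> C 0}) :
  (forall i, projective (P i)) -> (forall i x, dP i (dP i.+1 x) = 0) ->
  (forall i, exact_at (dC i.+1) (dC i)) ->
  (forall x, exists c, dC 0 c = a0 (dP 0 x)) ->
  exists a : forall i, {linear P i -> C i},
    a 0 = a0 /\ forall i x, dC i (a i.+1 x) = a i (dP i x).
Proof.
move=> Pp dd dCE h0.
pose ok i (ab : {linear P i -> C i} * {linear P i.+1 -> C i.+1}) :=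
  forall x, dC i (ab.2 x) = ab.1 (dP i x).
have step i (s : {ab | ok i ab}) : {t : {ab | ok i.+1 ab} | (sval t).1 = (sval s).2}.
  apply: cid; case: s => -[a b] /= abE.
  have [x|c cE] := @projective_lift _ _ _ _ (dC i.+1) (b \o dP i.+1) (Pp _).
    by apply/dCE; rewrite /= abE dd linear0.
  have cok : ok i.+1 (b, c) by [].
  by exists (exist _ _ cok).
have [a1 a1E] := @projective_lift _ _ _ _ (dC 0) (a0 \o dP 0) (Pp _) h0.
have s0ok : ok 0 (a0, a1) by [].
pose fix s i : {ab | ok i ab} :=
  match i with 0 => exist _ _ s0ok | j.+1 => sval (step j (s j)) end.
exists (fun i => (sval (s i)).1); split=> // i x.
rewrite [in LHS]/= (svalP (step i (s i))).
exact: (svalP (s i)).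
Qed.

Section Homotopy.
Variables (V V' : lmodType A) (S : proj_resolution V) (S' : proj_resolution V').

Lemma res_dd (i : nat) x : res_diff S i (res_diff S i.+1 x) = 0.
Proof. by apply/(@res_diff_exact _ _ S); exists x. Qed.

Lemma res_aug0 x : res_aug S (res_diff S 0 x) = 0.
Proof. by apply/(@res_aug_exact _ _ S).1; exists x. Qed.

Lemma lift_resolution (f : {linear V -> V'}) :
  exists a : forall i, {linear S i -> S' i},
    (forall x, res_aug S' (a 0 x) = f (res_aug S x)) /\
    forall i x, res_diff S' i (a i.+1 x) = a i (res_diff S i x).
Proof.
have [dE eS] := res_aug_exact S'.
have [x|a0 a0E] := @projective_lift _ _ _ _ (res_aug S') (f \o res_aug S)
  (@res_projective _ _ S 0); first exact: eS.
have [||||a [aE ac]] := @lift_chain S S' (res_diff S) (res_diff S') a0.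
- exact: res_projective.
- exact: res_dd.
- exact: res_diff_exact.
- by move=> x; apply/dE; rewrite a0E /= res_aug0 linear0.
- by exists a; split=> // x; rewrite aE a0E.
Qed.

(** Here [c] covers a map V -> V' that factors through [S' 0]. The factorisation contributes a term
    in degree 0 only, as it dies after composing with the first differential. Thus s = 0 gives the
    usual homotopy, and general [s] gives stable invariance. *)
Lemma chain_homotopy (c : forall i, {linear S i -> S' i}) (s : {linear V -> S' 0}) :
  (forall i x, res_diff S' i (c i.+1 x) = c i (res_diff S i x)) ->
  (forall x, res_aug S' (c 0 x) = res_aug S' (s (res_aug S x))) ->
  (exists h0 : {linear S 0 -> S' 1},
     forall x, c 0 x = s (res_aug S x) + res_diff S' 0 (h0 x)) /\
  forall i, exists (h : {linear S i -> S' i.+1}) (h' : {linear S i.+1 -> S' i.+2}),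
    forall x, c i.+1 x = h (res_diff S i x) + res_diff S' i.+1 (h' x).
Proof.
move=> cc c0; have [dE eS] := res_aug_exact S'.
have step i (k : {linear S i -> S' i}) (h : {linear S i -> S' i.+1}) :
    (forall x, k (res_diff S i x) = 0) ->
    (forall x, c i x = k x + res_diff S' i (h x)) ->
    exists h' : {linear S i.+1 -> S' i.+2},
      forall x, c i.+1 x = h (res_diff S i x) + res_diff S' i.+1 (h' x).
  move=> kd cE.
  have [x|h' h'E] := @projective_lift _ _ _ _ (res_diff S' i.+1)
      (c i.+1 \- (h \o res_diff S i)) (@res_projective _ _ S i.+1).
    apply/(@res_diff_exact _ _ S'); rewrite /= linearB cc cE kd add0r /=.
    by rewrite subrr.
  by exists h' => x; rewrite h'E /= addrC subrK.
have [x|h0 h0E] := @projective_lift _ _ _ _ (res_diff S' 0)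
    (c 0 \- (s \o res_aug S)) (@res_projective _ _ S 0).
  by apply/dE; rewrite /= linearB c0 subrr.
have {}h0E x : c 0 x = s (res_aug S x) + res_diff S' 0 (h0 x).
  by rewrite h0E /= addrC subrK.
split; first by exists h0.
elim=> [|i [h [h' h'E]]].
  have [x|h' h'E] := step 0 (s \o res_aug S) h0 _ h0E.
    by rewrite /= res_aug0 linear0.
  by exists h0, h'.
have [x|h2 h2E] := step i.+1 (h \o res_diff S i) h' _ h'E.
  by rewrite /= res_dd linear0.
by exists h', h2.
Qed.

(* The map [s] is zero when [c] lifts the zero map, which is what makes degree
   [0] work. *)
Lemma chain_homotopy_boundary (B : pzRingType) (D : bimodule A B)
    (c : forall i, {linear S i -> S' i}) (s : {linear V -> S' 0}) i (z : dual D (S' i)) :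
  (forall i x, res_diff S' i (c i.+1 x) = c i (res_diff S i x)) ->
  (forall x, res_aug S' (c 0 x) = res_aug S' (s (res_aug S x))) ->
  (i = 0 -> s =1 \0) -> codiff D S' i.+1 z = 0 ->
  exists u, codiff D S i u = dual_map D (c i) z.
Proof.
move=> cc c0 s0 zd.
have zd0 x : (z : {linear S' i -> D}) (res_diff S' i x) = 0.
  by have /(congr1 (fun w => dual_eval w x)) := zd.
have [[h0 h0E] hE] := chain_homotopy cc c0.
case: i z s0 zd zd0 => [|i] z s0 _ zd0.
  exists 0; rewrite linear0; apply: dual_ext => x /=.
  by rewrite h0E s0 // add0r zd0.
have [h [h' h'E]] := hE i; exists (dual_map D h z); apply: dual_ext => x /=.
by rewrite h'E linearD zd0 addr0.
Qed.

End Homotopy.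

Section ExtIso.
Variables (B : pzRingType) (D : bimodule A B).
Variables (V V' : lmodType A) (S : proj_resolution V) (S' : proj_resolution V').

Lemma Ext_map_exists (a : forall i, {linear S i -> S' i}) i :
  (forall i x, res_diff S' i (a i.+1 x) = a i (res_diff S i x)) ->
  exists t : {linear Ext D S' i -> Ext D S i},
  forall z h, hrep z h -> hrep (dual_map D (a i) z) (t h).
Proof.
move=> ac.
have cyc z : codiff D S' i.+1 z = 0 -> codiff D S i.+1 (dual_map D (a i) z) = 0.
  move=> zd; apply: dual_ext => x /=.
  by rewrite -ac; have /(congr1 (fun w => dual_eval w (a i.+1 x))) := zd.
have bd z : (exists u, codiff D S' i u = z) -> exists u, codiff D S i u = dual_map D (a i) z.
  case: i z {cyc} => [|i] z [u <-].
    by exists 0; rewrite linear0; apply: dual_ext.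
  by exists (dual_map D (a i) u); apply: dual_ext => x /=; rewrite ac.
have HS := hrepP (codiff D S i) (codiff D S i.+1).
have HS' := hrepP (codiff D S' i) (codiff D S' i.+1).
have [|||t tE] := @linear_of_rel _ (Ext D S' i) (Ext D S i)
  (fun h' h => exists2 z, hrep z h' & hrep (dual_map D (a i) z) h).
- move=> k h v h' v' [z zh zv] [z' zh' zv']; exists (k *: z + z').
    exact: (rep_linear HS').
  by rewrite linearP; exact: (rep_linear HS).
- move=> h'; have [z zh] := rep_surj HS' h'.
  have [h] := rep_total HS (cyc _ (rep_cycle HS' zh)).
  by exists h, z.
- move=> h [z zh zv]; apply/(rep0P HS zv)/bd.
  exact/(rep0P HS' zh).
exists t => z h zh.
have [v] := rep_total HS (cyc _ (rep_cycle HS' zh)) => zv.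
by have <- : v = t h by apply/esym/tE; exists z.
Qed.

End ExtIso.

Section StableExt.
Variables (B : pzRingType) (D : bimodule A B).

(** The chain map b a - id covers g f - id, which factors through [S 0]; by the homotopy the
    cocycles (b a)^* z and z differ by a coboundary. *)
Lemma Ext_cancel (V V' : lmodType A) (S : proj_resolution V) (S' : proj_resolution V')
    (f : {linear V -> V'}) (g : {linear V' -> V})
    (a : forall i, {linear S i -> S' i}) (b : forall i, {linear S' i -> S i})
    (s : {linear V -> S 0}) i
    (ta : {linear Ext D S' i -> Ext D S i}) (tb : {linear Ext D S i -> Ext D S' i}) :
  (forall i x, res_diff S' i (a i.+1 x) = a i (res_diff S i x)) ->
  (forall i x, res_diff S i (b i.+1 x) = b i (res_diff S' i x)) ->
  (forall x, res_aug S' (a 0 x) = f (res_aug S x)) ->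
  (forall x, res_aug S (b 0 x) = g (res_aug S' x)) ->
  (forall x, g (f x) - x = res_aug S (s x)) ->
  (i = 0 -> s =1 \0) ->
  (forall z h, hrep z h -> hrep (dual_map D (a i) z) (ta h)) ->
  (forall z h, hrep z h -> hrep (dual_map D (b i) z) (tb h)) ->
  cancel tb ta.
Proof.
move=> ac bc a0 b0 gf s0 taE tbE h.
have [z zh] := rep_surj (hrepP _ _) h.
apply: (rep_eq (hrepP _ _) (taE _ _ (tbE _ _ zh)) zh).
have [||//||u uE] := @chain_homotopy_boundary _ _ S S _ D
    (fun i => (b i \o a i) \- idfun) s i z.
- by move=> j x /=; rewrite linearB bc ac.
- by move=> x /=; rewrite linearB b0 a0 -gf.
- exact: (rep_cycle (hrepP _ _) zh).
- by exists u; rewrite uE; apply: dual_ext => x /=; rewrite linearB.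
Qed.

(** Zero [s] and [s'] give independence of the resolution in every degree; arbitrary ones give
    stable invariance in positive degree. *)
Lemma Ext_iso (V V' : lmodType A) (S : proj_resolution V) (S' : proj_resolution V')
    (f : {linear V -> V'}) (g : {linear V' -> V})
    (s : {linear V -> S 0}) (s' : {linear V' -> S' 0}) i :
  (forall x, g (f x) - x = res_aug S (s x)) ->
  (forall x, f (g x) - x = res_aug S' (s' x)) ->
  (i = 0 -> s =1 \0 /\ s' =1 \0) -> miso (Ext D S i) (Ext D S' i).
Proof.
move=> gf fg s0.
have [a [a0 ac]] := lift_resolution S S' f.
have [b [b0 bc]] := lift_resolution S' S g.
have [ta taE] := Ext_map_exists D i ac.
have [tb tbE] := Ext_map_exists D i bc.
exists tb, ta; split.
  by apply: (Ext_cancel ac bc a0 b0 gf) => // /s0[].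
by apply: (Ext_cancel bc ac b0 a0 fg) => // /s0[].
Qed.

Lemma Ext_resolution_iso (V : lmodType A) (S S' : proj_resolution V) i :
  miso (Ext D S i) (Ext D S' i).
Proof.
by apply: (Ext_iso (f := idfun) (g := idfun) (s := \0) (s' := \0)) => // x;
  rewrite /= linear0 subrr.
Qed.

(** The second factor lifts along the augmentation, so the single projective [S 0] serves for every
    factorisation. *)
Lemma factor_projective_aug (V U : lmodType A) (S : proj_resolution V) (f : U -> V) :
  factors_through_projective f ->
  exists s : {linear U -> S 0}, forall x, f x = res_aug S (s x).
Proof.
move=> [P [h [g [[_ Pp] fE]]]].
have [x|k kE] := @projective_lift _ _ _ _ (res_aug S) g Pp.
  exact: (res_aug_exact S).2.
by exists (k \o h) => x; rewrite fE /= kE.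
Qed.

Lemma Ext_stable_iso (V V' : lmodType A) (S : proj_resolution V)
    (S' : proj_resolution V') i :
  stably_iso V V' -> miso (Ext D S i.+1) (Ext D S' i.+1).
Proof.
move=> [f [g [/(factor_projective_aug S)[s sE] /(factor_projective_aug S')[s' s'E]]]].
exact: (Ext_iso sE s'E).
Qed.

End StableExt.
End Comparison.

(** * Stable isomorphism and its compatibility with syzygies *)

Section Stable.
Variable A : pzRingType.
Implicit Types U V W T K P : lmodType A.

Lemma stably_iso_refl V : stably_iso V V.
Proof.
exists idfun, idfun; split; exists ('rV[A]_0), \0, \0;
  by split=> [|x]; [apply: fg_projective_rV|rewrite /= subrr].
Qed.

Lemma stably_iso_sym U V : stably_iso U V -> stably_iso V U.
Proof. by move=> [f [g [? ?]]]; exists g, f. Qed.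

Lemma factors_add U V (f g : U -> V) :
  factors_through_projective f -> factors_through_projective g ->
  factors_through_projective (fun x => f x + g x).
Proof.
move=> [P [h [k [Pp fE]]]] [P' [h' [k' [Pp' gE]]]].
have [i iE] := linear_topair h h'; have [p pE] := linear_pair k k'.
exists (P * P')%type, i, p; split; first exact: fg_projective_pair.
by move=> x; rewrite fE gE /= pE iE.
Qed.

Lemma factors_comp U V V' U' (f : V -> V') (b : {linear U -> V}) (a : {linear V' -> U'}) :
  factors_through_projective f -> factors_through_projective (fun x => a (f (b x))).
Proof.
move=> [P [h [k [Pp fE]]]]; exists P, (h \o b), (a \o k).
by split=> // x; rewrite /= fE.
Qed.

(** g g' f' f - 1 = g (g' f' - 1) f + (g f - 1), and a sum of maps through projectives passes
    through their direct sum. *)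
Lemma stably_iso_trans U V W : stably_iso U V -> stably_iso V W -> stably_iso U W.
Proof.
move=> [f [g [gf fg]]] [f' [g' [gf' fg']]]; exists (f' \o f), (g \o g').
split.
  have := factors_add (factors_comp f g gf') gf.
  congr factors_through_projective; apply/funext => x /=.
  by rewrite linearB addrA subrK.
have := factors_add (factors_comp g' f' fg) fg'.
congr factors_through_projective; apply/funext => x /=.
by rewrite linearB addrA subrK.
Qed.

Lemma syzygy_map V V' K K' P P' (i : {linear K -> P}) (p : {linear P -> V})
    (i' : {linear K' -> P'}) (p' : {linear P' -> V'}) (f : {linear V -> V'}) :
  projective P -> short_exact i p -> short_exact i' p' ->
  exists (a : {linear P -> P'}) (k : {linear K -> K'}),
    (forall x, p' (a x) = f (p x)) /\ forall x, i' (k x) = a (i x).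
Proof.
move=> Pp [iI ip pS] [iI' ip' pS'].
have [x|a aE] := @projective_lift _ _ _ _ p' (f \o p) Pp; first exact: pS'.
have [x|k kE] := factor_inj (f := a \o i) iI'.
  apply/ip'; rewrite /= aE /=.
  by have -> : p (i x) = 0; [apply/ip; exists x|rewrite linear0].
by exists a, k.
Qed.

(** Let f = g h through [F], and lift [g] to s : F -> P'. Then a - s h p takes values in [K'] and
    restricts to [k] on [K], so [k] factors through [P]. *)
Lemma syzygy_factors V V' K K' P P' (i : {linear K -> P}) (p : {linear P -> V})
    (i' : {linear K' -> P'}) (p' : {linear P' -> V'}) (f : V -> V')
    (a : {linear P -> P'}) (k : {linear K -> K'}) :
  fg_projective P -> short_exact i p -> short_exact i' p' ->
  (forall x, p' (a x) = f (p x)) -> (forall x, i' (k x) = a (i x)) ->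
  factors_through_projective f -> factors_through_projective k.
Proof.
move=> Pp [iI ip pS] [iI' ip' pS'] aE kE [F [h [g [[_ Fp] fE]]]].
have [x|s sE] := @projective_lift _ _ _ _ p' g Fp; first exact: pS'.
have [x|b bE] := factor_inj (f := a \- (s \o h \o p)) iI'.
  by apply/ip'; rewrite /= linearB aE sE fE subrr.
exists P, i, b; split=> // x; apply: iI'; rewrite kE bE /=.
have -> : p (i x) = 0 by apply/ip; exists x.
by rewrite (linear0 h) (linear0 s) subr0.
Qed.

Lemma syzygy_stable V V' K K' :
  stably_iso V V' -> is_syzygy V K -> is_syzygy V' K' -> stably_iso K K'.
Proof.
move=> [f [g [gf fg]]] [P [i [p [Pp ip]]]] [P' [i' [p' [Pp' ip']]]].
have [a [k [aE kE]]] := syzygy_map f Pp.2 ip ip'.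
have [a' [k' [aE' kE']]] := syzygy_map g Pp'.2 ip' ip.
exists k, k'; split.
  apply: (@syzygy_factors _ _ _ _ _ _ i p i p (fun x => g (f x) - x)
    ((a' \o a) \- idfun) ((k' \o k) \- idfun)) => // x /=.
    by rewrite linearB aE' aE.
  by rewrite linearB kE' kE.
apply: (@syzygy_factors _ _ _ _ _ _ i' p' i' p' (fun x => f (g x) - x)
  ((a \o a') \- idfun) ((k \o k') \- idfun)) => // x /=.
  by rewrite linearB aE aE'.
by rewrite linearB kE kE'.
Qed.

Lemma syzygy_iter_stable V n K K' :
  iter_rel (@is_syzygy A) n V K -> iter_rel (@is_syzygy A) n V K' ->
  stably_iso K K'.
Proof.
elim: n K K' => [|n IHn] K K' /=; first by move=> <- <-; apply: stably_iso_refl.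
by move=> [W /IHn h WK] [W' /h s]; apply: syzygy_stable s WK.
Qed.

End Stable.

(** * Duality and transposes *)

(* [D] is free of rank one over [A] and over [B], on the same generator, and
   [D'] is [D] with the two actions exchanged. *)
Record duality (A B : pzRingType) (D : bimodule A B) (D' : bimodule B A) := Duality {
  swap : D -> D';
  unswap : D' -> D;
  unswapK : cancel unswap swap;
  swapK : cancel swap unswap;
  swapD : {morph swap : x y / x + y};
  swapZ : forall a x, swap (a *: x) = bimod_act a (swap x);
  swap_act : forall b x, swap (bimod_act b x) = b *: swap x;
  gen : D;
  acoord : D -> A;
  bcoord : D -> B;
  acoordK : forall x, acoord x *: gen = x;
  acoord_gen : forall a, acoord (a *: gen) = a;
  bcoordK : forall x, bimod_act (bcoord x) gen = x;
  bcoord_gen : forall b, bcoord (bimod_act b gen) = b }.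

Section DualEval.
Variables (A B : pzRingType) (D : bimodule A B) (X : lmodType A).

Lemma dual_eval_lin (f : dual D X) a x y :
  dual_eval f (a *: x + y) = a *: dual_eval f x + dual_eval f y.
Proof. exact: linearP. Qed.

Lemma dual_eval_sum (f : dual D X) (I : finType) (F : I -> X) :
  dual_eval f (\sum_i F i) = \sum_i dual_eval f (F i).
Proof. exact: linear_sum. Qed.

Lemma dual_evalZ (f : dual D X) a x : dual_eval f (a *: x) = a *: dual_eval f x.
Proof. exact: linearZ. Qed.

Lemma dual_evalD (f : dual D X) x y :
  dual_eval f (x + y) = dual_eval f x + dual_eval f y.
Proof. exact: linearD. Qed.

Lemma dual_evalN (f : dual D X) x : dual_eval f (- x) = - dual_eval f x.
Proof. exact: linearN. Qed.

Lemma dual_evalB (f : dual D X) x y :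
  dual_eval f (x - y) = dual_eval f x - dual_eval f y.
Proof. exact: linearB. Qed.

Lemma dual_eval0 (f : dual D X) : dual_eval f 0 = 0.
Proof. exact: linear0. Qed.

Lemma eval_dual_lin (f g : dual D X) b x :
  dual_eval (b *: f + g) x = bimod_act b (dual_eval f x) + dual_eval g x.
Proof. by []. Qed.

Lemma eval_dual_sum (I : finType) (F : I -> dual D X) x :
  dual_eval (\sum_i F i) x = \sum_i dual_eval (F i) x.
Proof. by apply: (big_morph (fun f => dual_eval f x)). Qed.

Lemma dualP (f g : dual D X) : (forall x, dual_eval f x = dual_eval g x) -> f = g.
Proof. exact: dual_ext. Qed.

Lemma dual_eval_map (Y : lmodType A) (u : {linear X -> Y}) (f : dual D Y) x :
  dual_eval (dual_map D u f) x = dual_eval f (u x).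
Proof. by []. Qed.

Lemma dual_of_fun (k : X -> D) : linear k -> exists f : dual D X, forall x, dual_eval f x = k x.
Proof. by move=> /linear_of_fun[f fE]; exists f. Qed.

Lemma dual_zero_module : is_zero_module X -> is_zero_module (dual D X).
Proof. by move=> X0 f; apply: dualP => x; rewrite (X0 x) !dual_eval0. Qed.

End DualEval.

Lemma dual_map_comp0 (A B : pzRingType) (D : bimodule A B) (X Y Z : lmodType A)
    (v : {linear X -> Y}) (u : {linear Y -> Z}) f :
  (forall x, u (v x) = 0) -> dual_map D v (dual_map D u f) = 0.
Proof. by move=> uv; apply: dualP => x; rewrite !dual_eval_map uv dual_eval0. Qed.

Section Duality.
Variables (A B : pzRingType) (D : bimodule A B) (D' : bimodule B A).
Variable du : duality D D'.
Implicit Types P : lmodType A.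

Lemma swap0 : swap du 0 = 0.
Proof. by apply: (addrI (swap du 0)); rewrite -swapD !addr0. Qed.

Lemma swap_sum (I : finType) (F : I -> D) : swap du (\sum_i F i) = \sum_i swap du (F i).
Proof. exact: (big_morph _ (swapD du) swap0). Qed.

Lemma bcoord_lin b x y : bcoord du (bimod_act b x + y) = b * bcoord du x + bcoord du y.
Proof.
rewrite -{1}(bcoordK du x) -{1}(bcoordK du y) bimod_actA -bimod_actDl.
exact: bcoord_gen.
Qed.

Section Evaluation.
Variable X : lmodType A.

Lemma eval_exists : exists ev : {linear X -> dual D' (dual D X)},
  forall x f, dual_eval (ev x) f = swap du (dual_eval f x).
Proof.
have evx x : exists e : dual D' (dual D X), forall f, dual_eval e f = swap du (dual_eval f x).
  by apply: dual_of_fun => b f g; rewrite eval_dual_lin swapD swap_act.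
pose ev x := sval (cid (evx x)).
have evE x f : dual_eval (ev x) f = swap du (dual_eval f x) by rewrite /ev; case: cid.
have [|e eE] := @linear_of_fun _ X (dual D' (dual D X)) ev.
  move=> a x y; apply: dualP => f.
  by rewrite eval_dual_lin !evE dual_eval_lin swapD swapZ.
by exists e => x f; rewrite eE evE.
Qed.

Definition ev : {linear X -> dual D' (dual D X)} := sval (cid eval_exists).

Lemma evE x f : dual_eval (ev x) f = swap du (dual_eval f x).
Proof. by rewrite /ev; case: cid. Qed.

End Evaluation.

Lemma ev_natural (X Y : lmodType A) (u : {linear X -> Y}) x :
  dual_map D' (dual_map D u) (ev X x) = ev Y (u x).
Proof. by apply: dualP => f; rewrite dual_eval_map !evE. Qed.

(** The classical dual basis property; [acoord] turns values in [D] into scalars. *)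
Definition dual_basis (P : lmodType A) n (x : 'I_n -> P) (f : 'I_n -> dual D P) : Prop :=
  forall p, p = \sum_i acoord du (dual_eval (f i) p) *: x i.

Lemma dual_basis_exists P : fg_projective P ->
  exists n (x : 'I_n -> P) (f : 'I_n -> dual D P), dual_basis x f.
Proof.
move=> [[n [p pS]] Pp]; have [s sE] := Pp _ _ p idfun pS.
exists n, (fun i => p (delta_mx 0 i)).
have fx i : exists f : dual D P, forall x, dual_eval f x = (s x) 0 i *: gen du.
  by apply: dual_of_fun => a x y; rewrite linearP !mxE scalerDl scalerA.
exists (fun i => sval (cid (fx i))) => x; rewrite -{1}[x]sE /=.
rewrite {1}(row_sum_delta (s x)) linear_sum; apply: eq_bigr => i _.
by rewrite linearZ /=; case: cid => f /= ->; rewrite acoord_gen.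
Qed.

(** The coordinates of a point act through [A], those of the g (x_i) through [B], and the two
    actions commute. Hence the f_i generate the dual, with coordinates linear in g, and the dual is
    a retract of B^n. *)
Lemma dual_basis_dual P n (x : 'I_n -> P) (f : 'I_n -> dual D P) (g : dual D P) :
  dual_basis x f -> g = \sum_i bcoord du (dual_eval g (x i)) *: f i.
Proof.
move=> xf; apply: dualP => p; rewrite eval_dual_sum {1}(xf p) dual_eval_sum.
apply: eq_bigr => i _; rewrite dual_evalZ -[dual_eval g (x i) in LHS](bcoordK du).
by rewrite -bimod_actC acoordK.
Qed.

Lemma fg_projective_dual P : fg_projective P -> fg_projective (dual D P).
Proof.
move=> /dual_basis_exists[n [x [f xf]]].
have [b [_ bE]] := linear_rV f.
have [|c cE] := @linear_of_fun _ (dual D P) ('rV[B]_n)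
    (fun g => \row_i bcoord du (dual_eval g (x i))).
  by move=> a g h; apply/rowP => i; rewrite !mxE eval_dual_lin bcoord_lin.
have bc g : b (c g) = g.
  rewrite {2}(dual_basis_dual g xf) bE; apply: eq_bigr => i _.
  by rewrite cE mxE.
split; first by exists n, b => g; exists (c g).
move=> U V u k uS; have [h hE] := projective_rV (k \o b) uS.
by exists (h \o c) => g; rewrite /= [LHS]hE /= bc.
Qed.

Lemma ev_inj P : fg_projective P -> injective (ev P).
Proof.
move=> /dual_basis_exists[n [x [f xf]]]; apply: linear_inj => p evp.
rewrite (xf p) big1 // => i _.
have : dual_eval (ev P p) (f i) = 0 by rewrite evp.
rewrite evE -swap0 => /(can_inj (swapK du)) ->.
by rewrite -[0 in LHS](scale0r (gen du)) acoord_gen scale0r.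
Qed.

Lemma ev_surj P : fg_projective P -> surj (ev P).
Proof.
move=> /dual_basis_exists[n [x [f xf]]] F.
(* The values of F on the generators f_i of the dual determine F, and they prescribe the coordinates
   of the preimage. *)
exists (\sum_i acoord du (unswap du (dual_eval F (f i))) *: x i).
apply: dualP => g; rewrite evE dual_eval_sum swap_sum.
rewrite [in RHS](dual_basis_dual g xf) dual_eval_sum; apply: eq_bigr => i _.
rewrite !dual_evalZ swapZ -{1}[dual_eval g (x i)](bcoordK du) swap_act.
by rewrite bimod_actC -swapZ acoordK unswapK.
Qed.

End Duality.

(** * The transpose as a stable duality *)

Section Transpose.
Variables (A B : pzRingType) (D : bimodule A B) (D' : bimodule B A).
Variable du : duality D D'.
Implicit Types (X Y P : lmodType A) (T : lmodType B).

(** The dualised presentation of [X] presents [T]. Its dual is the bidual of [d], which evaluation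
    identifies with [d] itself, whose cokernel is [X]. *)
Lemma transpose_sym X T : is_transpose D X T -> is_transpose D' T X.
Proof.
move=> [P1 [P0 [d [e [q [P1p P0p [de eS] dq]]]]]].
have [g gE] : exists g : {linear dual D' (dual D P0) -> P0}, forall x, ev du P0 (g x) = x.
  have [x|g gE] := factor_inj (f := idfun) (ev_inj (du := du) P0p).
    exact: (ev_surj du P0p).
  by exists g.
exists (dual D P0), (dual D P1), (dual_map D d), q, (e \o g); split=> //.
- exact: (fg_projective_dual du).
- exact: (fg_projective_dual du).
- split=> [F|x] /=; last first.
    have [p <-] := eS x; exists (ev du P0 p).
    by congr (e _); apply: (ev_inj (du := du) P0p); rewrite gE.
  rewrite de; split=> [[p pE]|[G <-]].
    by exists (ev du P1 p); rewrite ev_natural pE gE.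
  have [p <-] := ev_surj du P1p G; exists p.
  by apply: (ev_inj (du := du) P0p); rewrite gE ev_natural.
Qed.

Lemma presentation_map X X' (P1 P0 P1' P0' : lmodType A) (d : {linear P1 -> P0})
    (e : {linear P0 -> X}) (d' : {linear P1' -> P0'}) (e' : {linear P0' -> X'})
    (f : {linear X -> X'}) :
  projective P1 -> projective P0 -> right_exact d e -> right_exact d' e' ->
  exists (a0 : {linear P0 -> P0'}) (a1 : {linear P1 -> P1'}),
    (forall x, e' (a0 x) = f (e x)) /\ forall x, d' (a1 x) = a0 (d x).
Proof.
move=> P1p P0p [de eS] [de' eS'].
have [x|a0 a0E] := @projective_lift _ _ _ _ e' (f \o e) P0p; first exact: eS'.
have [x|a1 a1E] := @projective_lift _ _ _ _ d' (a0 \o d) P1p; last by exists a0, a1.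
by apply/de'; rewrite a0E /=; have -> : e (d x) = 0;
  [apply/de; exists x|rewrite linear0].
Qed.

Lemma transpose_map T T' (P1 P0 P1' P0' : lmodType A) (d : {linear P1 -> P0})
    (d' : {linear P1' -> P0'}) (a0 : {linear P0 -> P0'}) (a1 : {linear P1 -> P1'})
    (q : {linear dual D P1 -> T}) (q' : {linear dual D P1' -> T'}) :
  right_exact (dual_map D d) q -> right_exact (dual_map D d') q' ->
  (forall x, d' (a1 x) = a0 (d x)) ->
  exists t : {linear T' -> T}, forall z, t (q' z) = q (dual_map D a1 z).
Proof.
move=> [dq qS] [dq' qS'] aE.
have [z|t tE] := @factor_surj _ _ _ _ q' (q \o dual_map D a1) qS'; last by exists t.
move=> /dq'[w <-]; apply/dq; exists (dual_map D a0 w).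
by apply: dualP => x; rewrite !dual_eval_map aE.
Qed.

(** Let f = g h through [F], and lift [g] to s : F -> P0'. Then a0 - s h e = d' k for some k : P0 ->
    P1', so c = a1 - k d satisfies d' c = 0 and its dual induces a map T' -> P1^*. As [q] kills the
    dual of k d, [t] is that map followed by [q]. *)
Lemma transpose_factors X X' T T' (P1 P0 P1' P0' : lmodType A) (d : {linear P1 -> P0})
    (e : {linear P0 -> X}) (d' : {linear P1' -> P0'}) (e' : {linear P0' -> X'})
    (f : X -> X') (a0 : {linear P0 -> P0'}) (a1 : {linear P1 -> P1'})
    (q : {linear dual D P1 -> T}) (q' : {linear dual D P1' -> T'}) (t : {linear T' -> T}) :
  fg_projective P1 -> fg_projective P0 -> right_exact d e -> right_exact d' e' ->
  right_exact (dual_map D d) q -> right_exact (dual_map D d') q' ->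
  (forall x, e' (a0 x) = f (e x)) -> (forall x, d' (a1 x) = a0 (d x)) ->
  (forall z, t (q' z) = q (dual_map D a1 z)) ->
  factors_through_projective f -> factors_through_projective t.
Proof.
move=> P1p P0p [de eS] [de' eS'] [dq qS] [dq' qS'] a0E a1E tE [F [h [g [[_ Fp] fE]]]].
have [x|s sE] := @projective_lift _ _ _ _ e' g Fp; first exact: eS'.
have [x|k kE] := @projective_lift _ _ _ _ d' (a0 \- (s \o (h \o e))) P0p.2.
  by apply/de'; rewrite /= linearB a0E sE fE subrr.
have ed x : e (d x) = 0 by apply/de; exists x.
pose c := a1 \- (k \o d) : {linear P1 -> P1'}.
have dc x : d' (c x) = 0.
  by rewrite /c /= linearB a1E kE /= ed (linear0 h) (linear0 s) subr0 subrr.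
have [z|t' t'E] := @factor_surj _ _ _ _ q' (dual_map D c) qS'.
  move=> /dq'[w <-]; apply: dualP => x.
  by rewrite !dual_eval_map dc !dual_eval0.
exists (dual D P1), t', q; split; first exact: (fg_projective_dual du).
move=> y; have [z <-] := qS' y; rewrite tE /= t'E.
apply/eqP; rewrite -subr_eq0 -linearB; apply/eqP/dq.
exists (dual_map D k z); apply: dualP => x.
rewrite -[RHS]/(dual_eval z (a1 x) - dual_eval z (a1 x - k (d x))).
by rewrite dual_evalB opprB addrC subrK.
Qed.

Lemma transpose_stable X X' T T' :
  stably_iso X X' -> is_transpose D X T -> is_transpose D X' T' -> stably_iso T T'.
Proof.
move=> [f [g [gf fg]]] [P1 [P0 [d [e [q [P1p P0p de dq]]]]]]
  [P1' [P0' [d' [e' [q' [P1p' P0p' de' dq']]]]]].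
have [a0 [a1 [a0E a1E]]] := presentation_map f P1p.2 P0p.2 de de'.
have [b0 [b1 [b0E b1E]]] := presentation_map g P1p'.2 P0p'.2 de' de.
have [t tE] := transpose_map dq dq' a1E.
have [t' t'E] := transpose_map dq' dq b1E.
exists t', t; split.
  apply: (@transpose_factors _ _ _ _ _ _ _ _ d e d e (fun x => g (f x) - x)
    ((b0 \o a0) \- idfun) ((b1 \o a1) \- idfun) q q ((t \o t') \- idfun)) => // x /=.
  - by rewrite linearB b0E a0E.
  - by rewrite linearB b1E a1E.
  - rewrite t'E tE -linearB; congr (q _); apply: dualP => y.
    by rewrite !dual_eval_map /= [RHS]linearB.
apply: (@transpose_factors _ _ _ _ _ _ _ _ d' e' d' e' (fun x => f (g x) - x)
  ((a0 \o b0) \- idfun) ((a1 \o b1) \- idfun) q' q' ((t' \o t) \- idfun)) => // x /=.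
- by rewrite linearB a0E b0E.
- by rewrite linearB a1E b1E.
- rewrite tE t'E -linearB; congr (q' _); apply: dualP => y.
  by rewrite !dual_eval_map /= [RHS]linearB.
Qed.

End Transpose.

(** Each Sigma is Tr Omega Tr, and the outer Tr cancels against the next one because the transpose
    is stably an involution; what survives is Omega^n applied to [N]. The cancellation needs the
    duality in both directions. *)
Lemma sigma_syzygy (A B : pzRingType) (D : bimodule A B)
    (du : duality D (flip D)) (ud : duality (flip D) D)
    (K0 K : lmodType A) (N : lmodType B) (S : proj_resolution N) n (Z X : lmodType A) T :
  is_transpose D K0 N -> stably_iso K K0 -> fg_resolution S ->
  iter_rel (is_sigma D) n K Z -> stably_iso Z X -> is_transpose D X T ->
  stably_iso T (syzygy_of S n).
Proof.
move=> K0N KK0 Sfg; elim: n Z X T => [|n IHn] Z X T /=.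
  move=> <- /stably_iso_sym XK XT; apply: (transpose_stable du _ XT K0N).
  exact: stably_iso_trans XK KK0.
move=> [Z' Z'I [T' [K' [Z'T' T'K' K'Z]]]] /stably_iso_sym XZ XT.
have s1 := IHn _ _ _ Z'I (stably_iso_refl _) Z'T'.
have s2 := syzygy_stable s1 T'K' (syzygy_step n Sfg).
apply: stably_iso_trans s2.
exact: (transpose_stable du XZ XT (transpose_sym ud K'Z)).
Qed.

(** * The exact sequence of a cone *)

(* Long exact sequence of the cone of [(c1, c0)], whose tail is
   [P1 * Y0 -> P0 * Y1 -> Y2 -> Y3]. *)
Lemma cone_sequence (A : pzRingType) (P2 P1 P0 M Y0 Y1 Y2 Y3 H1 H2 K1 K2 : lmodType A)
    (d2 : {linear P2 -> P1}) (d1 : {linear P1 -> P0}) (e : {linear P0 -> M})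
    (b0 : {linear Y0 -> Y1}) (b1 : {linear Y1 -> Y2}) (b2 : {linear Y2 -> Y3})
    (c1 : {linear P1 -> Y1}) (c0 : {linear P0 -> Y2})
    (F : {linear (P1 * Y0)%type -> (P0 * Y1)%type}) (E : {linear (P0 * Y1)%type -> Y2})
    (rep1 : Y1 -> H1 -> Prop) (rep2 : Y2 -> H2 -> Prop)
    (repK1 : P0 * Y1 -> K1 -> Prop) (repK2 : Y2 -> K2 -> Prop) :
  exact_at d2 d1 -> right_exact d1 e ->
  (forall x, b2 (c0 x) = 0) -> (forall y, c0 (d1 y) = b1 (c1 y)) ->
  (forall z, exists v, b0 v = c1 (d2 z)) ->
  (forall y, F y = (d1 y.1, c1 y.1 - b0 y.2)) ->
  (forall x, E x = c0 x.1 - b1 x.2) ->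
  is_homology b0 b1 rep1 -> is_homology b1 b2 rep2 ->
  is_homology F E repK1 -> is_homology E b2 repK2 ->
  exists (f : {linear H1 -> K1}) (g : {linear K1 -> M}) (sigma : {linear M -> H2})
    (h : {linear H2 -> K2}),
    [/\ injective f, exact_at f g, exact_at g sigma, exact_at sigma h & surj h] /\
    forall x, rep2 (c0 x) (sigma (e x)).
Proof.
move=> d2d1 [d1e eS] b2c0 c0d1 c1d2 FE EE h1 h2 k1 k2.
have [|||f fE] := @linear_of_rel _ H1 K1
  (fun h k => exists2 w, rep1 w h & repK1 (0, w) k).
- move=> a h k h' k' [w wh wk] [w' wh' wk']; exists (a *: w + w').
    exact: (rep_linear h1).
  have := rep_linear k1 a wk wk'; congr (repK1 _ _).
  by congr (_, _); rewrite /= scaler0 addr0.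
- move=> h; have [w wh] := rep_surj h1 h.
  have [|k kE] := rep_total k1 (v := (0, w)); last by exists k, w.
  by rewrite EE /= linear0 (rep_cycle h1 wh) subrr.
- move=> k [w wh wk]; apply/(rep0P k1 wk).
  have [u <-] := (rep0P h1 wh).1 erefl.
  by exists (0, - u); rewrite FE /= !linear0 linearN opprK add0r.
have [|||g gE] := @linear_of_rel _ K1 M
  (fun k m => exists2 x, repK1 x k & e x.1 = m).
- move=> a h k h' k' [x xh <-] [x' xh' <-]; exists (a *: x + x').
    exact: (rep_linear k1).
  by rewrite /= linearP.
- by move=> k; have [x xk] := rep_surj k1 k; exists (e x.1), x.
- move=> m [x xk <-]; have [y <-] := (rep0P k1 xk).1 erefl.
  by rewrite FE /=; apply/d1e; exists y.1.
have [|||s sE] := @linear_of_rel _ M H2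
  (fun m h => exists2 x, e x = m & rep2 (c0 x) h).
- move=> a h k h' k' [x <- xk] [x' <- xk']; exists (a *: x + x').
    by rewrite linearP.
  by rewrite linearP; apply: (rep_linear h2).
- move=> m; have [x <-] := eS m.
  by have [h hE] := rep_total h2 (b2c0 x); exists h, x.
- move=> h [x /d1e[y <-]]; rewrite c0d1 => yh.
  by apply/(rep0P h2 yh); exists (c1 y).
have [|||t tE] := @linear_of_rel _ H2 K2 (fun h k => exists2 y, rep2 y h & repK2 y k).
- move=> a h k h' k' [y yh yk] [y' yh' yk']; exists (a *: y + y').
    exact: (rep_linear h2).
  exact: (rep_linear k2).
- move=> h; have [y yh] := rep_surj h2 h.
  by have [k kE] := rep_total k2 (rep_cycle h2 yh); exists k, y.
- move=> k [y yh yk]; apply/(rep0P k2 yk).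
  have [w <-] := (rep0P h2 yh).1 erefl.
  by exists (0, - w); rewrite EE /= linear0 linearN opprK add0r.
have sP x : rep2 (c0 x) (s (e x)).
  have [h hE] := rep_total h2 (b2c0 x).
  by have <- : h = s (e x) by apply/esym/sE; exists x.
exists f, g, s, t; split=> //; split.
- apply: linear_inj => h fh; have /fE[w wh wk] := fh.
  (* (0, w) = F (y, v) forces d1 y = 0, so y = d2 z, and c1 (d2 z) lies in the image of [b0]. *)
  have [[y v]] := (rep0P k1 wk).1 erefl; rewrite FE /= => -[/d2d1[z <-]].
  have [v' <-] := c1d2 z => wE.
  by apply/(rep0P h1 wh); exists (v' - v); rewrite linearB wE.
- move=> k; split=> [|[h hE]]; last first.
    by have /fE[w _ wk] := hE; apply/gE; exists (0, w); rewrite /= ?linear0.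
  move/gE => [[x w] xk /= /d1e[y yE]].
  (* Subtracting this boundary moves the cycle into the summand [Y1]. *)
  have Fy0 : F (y, 0) = (x, c1 y) by rewrite FE /= yE linear0 subr0.
  have cyc : b1 (w - c1 y) = 0.
    by have := rep_cycle k1 xk; rewrite EE /= -yE c0d1 linearB => /eqP;
      rewrite subr_eq0 => /eqP->; rewrite subrr.
  have [h hE] := rep_total h1 cyc; exists h; apply/fE; exists (w - c1 y) => //.
  have [|k' k'E] := rep_total k1 (v := (0, w - c1 y)).
    by rewrite EE /= linear0 cyc subrr.
  have -> // : k = k'.
  apply: (rep_eq k1 xk k'E); exists (y, 0); rewrite Fy0.
  by congr (_, _); rewrite /= ?subr0 // subKr.
- move=> m; split=> [/sE[x <- xh]|[k /gE[[x w] xk <-]]] /=.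
    have [w wE] := (rep0P h2 xh).1 erefl.
    have [|k kE] := rep_total k1 (v := (x, w)).
      by rewrite EE /= wE subrr.
    by exists k; apply/gE; exists (x, w).
  apply/(rep0P h2 (sP x)); exists w; apply/esym/eqP.
  by rewrite -subr_eq0 -(rep_cycle k1 xk) EE.
- move=> h; split=> [/tE[y yh yk]|[m mE]].
    have [[x w] xw] := (rep0P k2 yk).1 erefl; exists (e x).
    apply: (rep_eq h2 (sP x) yh); exists w.
    by rewrite -xw EE /= subKr.
  have /sE[x _ xh] := mE; apply/tE; exists (c0 x) => //.
  have [k kE] := rep_total k2 (b2c0 x).
  have <- // : k = 0; apply/(rep0P k2 kE); exists (x, 0).
  by rewrite EE /= linear0 subr0.
- move=> k; have [y yk] := rep_surj k2 k.
  have [h hE] := rep_total h2 (rep_cycle k2 yk).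
  by exists h; apply/tE; exists y.
Qed.

Section DualPair.
Variables (A B : pzRingType) (D : bimodule A B) (U V : lmodType A).

Lemma dual_pair_exists :
  exists l : {linear (dual D U * dual D V)%type -> dual D (U * V)%type},
  forall x y, dual_eval (l x) y = dual_eval x.1 y.1 + dual_eval x.2 y.2.
Proof.
have lx (x : dual D U * dual D V) : exists l : dual D (U * V)%type,
    forall y, dual_eval l y = dual_eval x.1 y.1 + dual_eval x.2 y.2.
  by apply: dual_of_fun => a y z /=; rewrite !dual_eval_lin scalerDr addrACA.
pose l x := sval (cid (lx x)).
have lE x y : dual_eval (l x) y = dual_eval x.1 y.1 + dual_eval x.2 y.2.
  by rewrite /l; case: cid.
have [|k kE] := @linear_of_fun _ (dual D U * dual D V)%type (dual D (U * V)%type) l.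
  move=> a x y; apply: dualP => u.
  by rewrite eval_dual_lin !lE bimod_actDr addrACA.
by exists k => x y; rewrite kE lE.
Qed.

Definition dual_pair : {linear (dual D U * dual D V)%type -> dual D (U * V)%type} :=
  sval (cid dual_pair_exists).

Lemma dual_pairE x y :
  dual_eval (dual_pair x) y = dual_eval x.1 y.1 + dual_eval x.2 y.2.
Proof. by rewrite /dual_pair; case: cid. Qed.

Lemma dual_pair_inj : injective dual_pair.
Proof.
apply: linear_inj => -[x w] e; congr (_, _); apply: dualP => u.
  have := congr1 (fun z => dual_eval z (u, 0)) e.
  by rewrite dual_pairE /= dual_eval0 addr0.
have := congr1 (fun z => dual_eval z (0, u)) e.
by rewrite dual_pairE /= dual_eval0 add0r.
Qed.

Lemma dual_pair_eq0 x w : dual_pair (x, w) = 0 -> w = 0.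
Proof.
move=> e; have /dual_pair_inj[] // : dual_pair (x, w) = dual_pair (0, 0).
by rewrite e linear0.
Qed.

Lemma dual_pair_surj : surj dual_pair.
Proof.
move=> z.
have [x xE] : exists x : dual D U, forall u, dual_eval x u = dual_eval z (u, 0).
  apply: dual_of_fun => a u v; rewrite -dual_eval_lin; congr (dual_eval z _).
  by congr (_, _); rewrite /= scaler0 addr0.
have [w wE] : exists w : dual D V, forall u, dual_eval w u = dual_eval z (0, u).
  apply: dual_of_fun => a u v; rewrite -dual_eval_lin; congr (dual_eval z _).
  by congr (_, _); rewrite /= scaler0 addr0.
exists (x, w); apply: dualP => -[u v]; rewrite dual_pairE /= xE wE.
rewrite -[X in X + _]scale1r -dual_eval_lin; congr (dual_eval z _).
by congr (_, _); rewrite /= scale1r ?addr0 ?add0r.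
Qed.

End DualPair.

(** * The cone as a projective resolution of N, and its dual *)

Section Cone.
Variables (A B : pzRingType) (D : bimodule A B) (D' : bimodule B A).
Variable du : duality D D'.
Variables (M : lmodType A) (P : proj_resolution M) (Pfg : fg_resolution P).

(* The complex [0 -> P_0^* -> ... -> P_n^*], indexed from [P_n^*] downwards. *)
Fixpoint dual_rev (n i : nat) {struct i} : lmodType B :=
  match i with
  | 0 => dual D (P n)
  | j.+1 => match n with 0 => 'rV[B]_0 | m.+1 => dual_rev m j end
  end.

(** Decreasing i and n together makes [dual_rev n.+1 i.+1] convertible to [dual_rev n i]: the
    complex for n.+1 is that for n with one more term at the bottom. *)
Fixpoint rev_diff (n i : nat) {struct i} : {linear dual_rev n i.+1 -> dual_rev n i} :=
  match i return {linear dual_rev n i.+1 -> dual_rev n i} with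
  | 0 => match n return {linear dual_rev n 1 -> dual_rev n 0} with
         | 0 => \0
         | m.+1 => dual_map D (res_diff P m)
         end
  | j.+1 => match n return {linear dual_rev n j.+2 -> dual_rev n j.+1} with
            | 0 => \0
            | m.+1 => rev_diff m j
            end
  end.

Lemma rev_boundary n (z : dual D (P n)) :
  (exists u, rev_diff n 0 u = z) <-> exists u, codiff D P n u = z.
Proof. by case: n z. Qed.

Lemma dual_rev_projective n i : projective (dual_rev n i).
Proof.
elim: i n => [|i IHi] n /=; first exact: (fg_projective_dual du (Pfg n)).2.
by case: n => [|n]; [apply: projective_rV|apply: IHi].
Qed.

Lemma dual_rev_zero n : is_zero_module (dual_rev n n.+1).
Proof. by elim: n => [|n IHn]; [apply: zero_rV0|exact: IHn]. Qed.

(** For i < n, position i.+1 holds P_j^* with j = n - i - 1, where the homology is Ext^j; later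
    positions are zero. *)
Lemma rev_exact n : (forall j, (j < n)%N -> is_zero_module (Ext D P j)) ->
  forall i, exact_at (rev_diff n i.+1) (rev_diff n i).
Proof.
elim: n => [|n IHn] van i.
  case: i => [|i] /= v; split=> [_|]; rewrite (@zero_rV0 _ v) ?linear0 //.
  by exists 0; rewrite linear0.
  by exists 0; rewrite linear0.
case: i => [|i]; last by apply: IHn => j jn; apply/van/ltnW.
move=> z; rewrite (rev_boundary (n := n)).
have H := hrepP (codiff D P n) (codiff D P n.+1).
split=> [zd|[u <-]].
  have [h zh] := rep_total H (v := z) zd.
  by apply/(rep0P H zh)/van.
case: n {IHn van z H} u => [|n] u; first by rewrite /= linear0.
by apply: dual_map_comp0 => x; apply: res_dd.
Qed.

(** The last nonzero term [dual_rev n n] is P_0^*, but reduces to it only for a concrete n. The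
    evaluation maps of P_0, P_1, P_2 are therefore transported by an induction whose step is a
    conversion. *)
Lemma top_eval n :
  exists (t0 : {linear P 0 -> dual D' (dual_rev n n)})
         (t1 : {linear P 1 -> dual D' (dual_rev n.+1 n)})
         (t2 : {linear P 2 -> dual D' (dual_rev n.+2 n)}),
    [/\ injective t0, surj t0, surj t1,
        forall y, dual_map D' (rev_diff n.+1 n) (t1 y) = t0 (res_diff P 0 y)
      & forall z, dual_map D' (rev_diff n.+2 n) (t2 z) = t1 (res_diff P 1 z)].
Proof.
elim: n => [|n IHn]; last exact: IHn.
exists (ev du (P 0)), (ev du (P 1)), (ev du (P 2)); split.
- exact: ev_inj.
- exact: ev_surj.
- exact: ev_surj.
- exact: ev_natural.
- exact: ev_natural.
Qed.

Variables (n : nat) (Q : proj_resolution (Ext D P n)).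

(** The augmentation of [Q] lifts through the surjection from cocycles of P_n^* to Ext^n. The lift
    extends because boundaries of [Q] have class 0 and the complex is exact further up. *)
Lemma lift_to_cocycles :
  (forall j, (j < n)%N -> is_zero_module (Ext D P j)) ->
  exists phi : forall i, {linear Q i -> dual_rev n i},
    (forall i x, rev_diff n i (phi i.+1 x) = phi i (res_diff Q i x)) /\
    forall x, hrep (phi 0 x : dual D (P n)) (res_aug Q x).
Proof.
move=> van; have H := hrepP (codiff D P n) (codiff D P n.+1).
have [c cE] := homology_class (codiff D P n) (codiff D P n.+1).
have [h|p pE] := @projective_lift _ _ _ _ c (res_aug Q) (@res_projective _ _ Q 0).
  exact: (homology_class_surj cE).
pose phi0 : {linear Q 0 -> dual D (P n)} := ker_inc _ \o p.
have phi0E x : hrep (phi0 x) (res_aug Q x) by apply/cE; rewrite pE.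
have [||||phi [phi0P phic]] := @lift_chain B Q (dual_rev n) (res_diff Q) (rev_diff n) phi0.
- exact: res_projective.
- exact: res_dd.
- exact: rev_exact.
- move=> x; apply/rev_boundary/(rep0P H (phi0E _)).
  exact: res_aug0.
- by exists phi; split=> // x; rewrite phi0P.
Qed.

Variable phi : forall i, {linear Q i -> dual_rev n i}.
Hypothesis phi_chain : forall i x, rev_diff n i (phi i.+1 x) = phi i (res_diff Q i x).
Hypothesis phi_aug : forall x, hrep (phi 0 x : dual D (P n)) (res_aug Q x).
Hypothesis vanish : forall j, (j < n)%N -> is_zero_module (Ext D P j).
Variables (N : lmodType B) (q : {linear dual D (P n.+1) -> N}).
Hypothesis dq : right_exact (dual_map D (res_diff P n)) q.

(** The shift is by two: one for P_(n+1)^*, which lies below the complex that receives [Q], and one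
    for the cone. *)
Definition shiftQ (i : nat) : lmodType B :=
  match i with j.+2 => Q j | _ => 'rV[B]_0 end.

Definition shiftQ_diff (i : nat) : {linear shiftQ i.+1 -> shiftQ i} :=
  match i return {linear shiftQ i.+1 -> shiftQ i} with
  | j.+2 => res_diff Q j
  | _ => \0
  end.

Definition shift_phi (i : nat) : {linear shiftQ i.+1 -> dual_rev n.+1 i} :=
  match i return {linear shiftQ i.+1 -> dual_rev n.+1 i} with
  | j.+1 => phi j
  | 0 => \0
  end.

Lemma shift_phi_chain i x :
  rev_diff n.+1 i (shift_phi i.+1 x) = shift_phi i (shiftQ_diff i.+1 x).
Proof.
case: i x => [|i] x /=; last exact: phi_chain.
exact: (rep_cycle (hrepP (codiff D P n) (codiff D P n.+1)) (phi_aug x)).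
Qed.

Lemma shiftQ_dd i x : shiftQ_diff i (shiftQ_diff i.+1 x) = 0.
Proof. by case: i x => [|[|i]] x //=; apply: res_dd. Qed.

Definition cone (i : nat) : lmodType B := (dual_rev n.+1 i * shiftQ i)%type.

Lemma cone_diff_exists i : exists d : {linear cone i.+1 -> cone i},
  forall x, d x = (rev_diff n.+1 i x.1 + shift_phi i x.2, - shiftQ_diff i x.2).
Proof.
apply: linear_of_fun => a x y; congr (_, _) => /=.
  by rewrite !linearP scalerDr addrACA.
by rewrite linearP opprD scalerN.
Qed.

Definition cone_diff i : {linear cone i.+1 -> cone i} := sval (cid (cone_diff_exists i)).

Lemma cone_diffE i x :
  cone_diff i x = (rev_diff n.+1 i x.1 + shift_phi i x.2, - shiftQ_diff i x.2).
Proof. by rewrite /cone_diff; case: cid. Qed.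

Lemma cone_projective i : projective (cone i).
Proof.
apply: projective_pair; first exact: dual_rev_projective.
by case: i => [|[|i]]; [apply: projective_rV|apply: projective_rV|apply: res_projective].
Qed.

(** At i = 0 the composite passes through P_n^*, where the homology is Ext^n, so exactness gives
    nothing there and the differentials of [P] are used directly. *)
Lemma rev_dd i x : rev_diff n.+1 i (rev_diff n.+1 i.+1 x) = 0.
Proof.
case: i x => [|i] x; last by apply/(rev_exact vanish); exists x.
have [u uE] : exists u, codiff D P n u = rev_diff n.+1 1 x.
  by apply/rev_boundary; exists x.
rewrite -uE; case: (n) u {uE x} => [|m] u; first by rewrite /= !linear0.
by apply: dual_map_comp0 => x; apply: res_dd.
Qed.

Lemma cone_aug_exists : exists a : {linear cone 0 -> N}, right_exact (cone_diff 0) a.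
Proof.
have [a aE] := @linear_of_fun _ (cone 0) N (fun x => q x.1) (fun _ _ _ => linearP q _ _ _).
have [dqE qS] := dq; exists a; split=> [[x y]|v]; last first.
  by have [x <-] := qS v; exists (x, 0); rewrite aE.
rewrite aE /= dqE; split=> [[u <-]|[[u v]]].
  exists (u, 0); rewrite cone_diffE /= addr0; congr (_, _).
  by rewrite (@zero_rV0 _ y) oppr0.
by rewrite cone_diffE /= addr0 => -[<- _]; exists u.
Qed.

(** Above degree 0 the extended dual complex has homology only at P_n^*, namely Ext^n; the
    resolution [Q], attached by [phi], kills exactly that. *)
Lemma cone_exact i : exact_at (cone_diff i.+1) (cone_diff i).
Proof.
move=> [g y]; rewrite cone_diffE /=; split=> [|[[g' y']]]; last first.
  rewrite cone_diffE => -[<- <-]; congr (_, _) => /=.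
    by rewrite linearD rev_dd add0r shift_phi_chain linearN subrr.
  by rewrite linearN opprK shiftQ_dd.
move=> [gy /eqP]; rewrite oppr_eq0 => /eqP yd.
case: i g y gy yd => [|i] g y gy yd.
  (* The summand from [Q] is zero in this degree, so g is a cocycle; its class is the augmentation
     of some x, and g - phi 0 x is a boundary. *)
  have H := hrepP (codiff D P n) (codiff D P n.+1).
  have [h gh] : exists h : Ext D P n, hrep (g : dual D (P n)) h.
    by apply: (rep_total H); move: gy; rewrite /= addr0.
  have [x xE] := (res_aug_exact Q).2 h.
  have /rev_boundary[u uE] : exists u, codiff D P n u = g - phi 0 x.
    have r := rep_linear H (-1) (phi_aug x) gh.
    have r0 : -1 *: res_aug Q x + h = 0 by rewrite xE scaleN1r addNr.
    by have [u uE] := (rep0P H r).1 r0; exists u; rewrite uE scaleN1r addrC.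
  exists (u, x : shiftQ 2); rewrite cone_diffE; congr (_, _) => /=.
    by rewrite [rev_diff n 0 u]uE subrK.
  by rewrite oppr0; apply/esym/zero_rV0.
have [y1 y1E] : exists y1, res_diff Q i y1 = y.
  case: i g y gy yd => [|i] g y gy yd; last exact/(@res_diff_exact _ _ Q).
  (* phi 0 y is the boundary of - g, so the class it represents, the augmentation of y, vanishes. *)
  apply/(res_aug_exact Q).1.
  have H := hrepP (codiff D P n) (codiff D P n.+1).
  apply/(rep0P H (phi_aug y))/rev_boundary; exists (- g).
  by apply/eqP; rewrite linearN eq_sym -addr_eq0 addrC; apply/eqP.
have [g3 g3E] : exists g3, rev_diff n.+1 i.+2 g3 = g + phi i.+1 y1.
  apply/(rev_exact vanish); rewrite linearD phi_chain y1E.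
  exact: gy.
exists (g3, - y1 : shiftQ i.+3); rewrite cone_diffE; congr (_, _) => /=.
  by rewrite [rev_diff n i.+1 g3]g3E linearN addrK.
by rewrite linearN opprK y1E.
Qed.

Definition cone_resolution : proj_resolution N :=
  ProjResolution cone_projective (svalP (cid cone_aug_exists)) cone_exact.

Lemma cone_dual i x w :
  dual_map D' (cone_diff i) (dual_pair D' _ _ (x, w)) =
  dual_pair D' _ _ (dual_map D' (rev_diff n.+1 i) x,
    dual_map D' (shift_phi i) x - dual_map D' (shiftQ_diff i) w).
Proof.
apply: dualP => -[g y]; rewrite dual_eval_map cone_diffE !dual_pairE.
change (dual_eval x (rev_diff n.+1 i g + shift_phi i y)
    + dual_eval w (- shiftQ_diff i y) = dual_eval x (rev_diff n.+1 i g)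
    + (dual_eval x (shift_phi i y) - dual_eval w (shiftQ_diff i y))).
by rewrite dual_evalD dual_evalN addrA.
Qed.

(** Only m = 0 needs care: the incoming zero map starts from the dual of a zero module instead of
    ['rV_0]. *)
Lemma shiftQ_homology m :
  is_homology (dual_map D' (shiftQ_diff m.+1)) (dual_map D' (shiftQ_diff m.+2))
    (hrep (f := codiff D' Q m) (g := codiff D' Q m.+1)).
Proof.
have H := hrepP (codiff D' Q m) (codiff D' Q m.+1).
split; try by case: H.
move=> v h /(rep0P H) ->; case: m v {h H} => [|m] v //.
split=> -[u <-]; exists 0; first by rewrite linear0.
by rewrite linear0; apply: dualP => x; rewrite dual_eval_map /= dual_eval0.
Qed.

(** For m = 0 the homology is taken at a zero module and represents Ext^(-1) = 0, so the full
    relation will do. *)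
Lemma shiftQ_homology_pred m :
  exists rep : dual D' (shiftQ m.+1) -> Ext_pred D' Q m -> Prop,
  is_homology (dual_map D' (shiftQ_diff m)) (dual_map D' (shiftQ_diff m.+1)) rep.
Proof.
case: m => [|m]; last by eexists; apply: shiftQ_homology.
have Z : is_zero_module (dual D' (shiftQ 1)) by apply/dual_zero_module/zero_rV0.
exists (fun _ _ => True); split=> //.
- by move=> v _; exists 0.
- by move=> v _ _; rewrite (Z v) linear0.
- by move=> h; exists 0.
- move=> v h _; split=> _; last exact: zero_rV0.
  by exists 0; rewrite linear0; apply/esym/Z.
Qed.

Section Sequence.
Variables (t0 : {linear P 0 -> dual D' (dual_rev n n)})
  (t1 : {linear P 1 -> dual D' (dual_rev n.+1 n)}).
Hypotheses (t0I : injective t0) (t0S : surj t0) (t1S : surj t1).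
Hypothesis t1d : forall y, dual_map D' (rev_diff n.+1 n) (t1 y) = t0 (res_diff P 0 y).
Hypothesis t1dd : forall z, exists v,
  dual_map D' (shiftQ_diff n) v = dual_map D' (shift_phi n) (t1 (res_diff P 1 z)).

Let c1 : {linear P 1 -> dual D' (shiftQ n.+1)} := dual_map D' (shift_phi n) \o t1.
Let c0 : {linear P 0 -> dual D' (shiftQ n.+2)} := dual_map D' (shift_phi n.+1) \o t0.
Let b0 : {linear dual D' (shiftQ n) -> dual D' (shiftQ n.+1)} :=
  dual_map D' (shiftQ_diff n).
Let b1 : {linear dual D' (shiftQ n.+1) -> dual D' (shiftQ n.+2)} :=
  dual_map D' (shiftQ_diff n.+1).
Let b2 : {linear dual D' (shiftQ n.+2) -> dual D' (shiftQ n.+3)} :=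
  dual_map D' (shiftQ_diff n.+2).

Let dual_top0 (x : dual D' (dual_rev n.+1 n.+2)) : x = 0.
Proof. exact/dual_zero_module/dual_rev_zero. Qed.

Lemma cone_cocycle p w :
  dual_map D' (cone_diff n.+1) (dual_pair D' _ _ (t0 p, w)) =
  dual_pair D' _ _ (0, c0 p - b1 w).
Proof. by rewrite cone_dual [X in dual_pair D' _ _ (X, _)]dual_top0. Qed.

Lemma cone_boundary y v :
  dual_map D' (cone_diff n) (dual_pair D' _ _ (t1 y, v)) =
  dual_pair D' _ _ (t0 (res_diff P 0 y), c1 y - b0 v).
Proof. by rewrite cone_dual t1d. Qed.

(** Through [t0] and [t1] the bidual terms at the end of the dualised cone become P_0 and P_1, and
    its differentials become [E] and [F]. Cycles need [t0] bijective; boundaries need [t1] onto. *)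
Lemma cone_homology1 (F : {linear (P 1 * dual D' (shiftQ n))%type ->
      (P 0 * dual D' (shiftQ n.+1))%type})
    (E : {linear (P 0 * dual D' (shiftQ n.+1))%type -> dual D' (shiftQ n.+2)}) :
  (forall y, F y = (res_diff P 0 y.1, c1 y.1 - b0 y.2)) ->
  (forall x, E x = c0 x.1 - b1 x.2) ->
  is_homology F E (fun x (k : Ext D' cone_resolution n.+1) =>
    hrep (dual_pair D' _ _ (t0 x.1, x.2)) k).
Proof.
move=> FE EE.
have H := hrepP (codiff D' cone_resolution n.+1) (codiff D' cone_resolution n.+2).
split.
- move=> a x h x' h' xh xh'; have := rep_linear H a xh xh'; congr (hrep _ _).
  rewrite -linearP; apply: (congr1 (dual_pair D' _ _)); congr (_, _).
  exact/esym/linearP.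
- move=> [p w] Ep; apply: (rep_total H); rewrite [LHS]cone_cocycle.
  by have := Ep; rewrite EE => ->; apply: linear0.
- move=> [p w] h /(rep_cycle H); rewrite [LHS]cone_cocycle EE.
  exact: dual_pair_eq0.
- move=> h; have [z zh] := rep_surj H h.
  have [[x w] xw] := @dual_pair_surj _ _ D' _ _ z.
  by have [p pE] := t0S x; exists (p, w); rewrite /= pE xw.
- move=> [p w] h /(rep0P H) ->; split=> [[u uE]|[[y v]]].
    have [[x v] xv] := @dual_pair_surj _ _ D' _ _ u.
    have [y yE] := t1S x; move: uE; rewrite -xv -yE [LHS]cone_boundary.
    by move=> /dual_pair_inj[/t0I <- <-]; exists (y, v); rewrite FE.
  rewrite FE /= => -[<- <-]; exists (dual_pair D' _ _ (t1 y, v)).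
  exact: cone_boundary.
Qed.

(** In degree n.+2 the dual complex has run out, so only the summand from [Q] remains. *)
Lemma cone_homology2
    (E : {linear (P 0 * dual D' (shiftQ n.+1))%type -> dual D' (shiftQ n.+2)}) :
  (forall x, E x = c0 x.1 - b1 x.2) ->
  is_homology E b2 (fun w (k : Ext D' cone_resolution n.+2) =>
    hrep (dual_pair D' (dual_rev n.+1 n.+2) (shiftQ n.+2) (0, w)) k).
Proof.
move=> EE.
have H := hrepP (codiff D' cone_resolution n.+2) (codiff D' cone_resolution n.+3).
have cyc w : dual_map D' (cone_diff n.+2) (dual_pair D' _ _ (0, w)) =
    dual_pair D' _ _ (0, - b2 w).
  by rewrite cone_dual !linear0 sub0r.
split.
- move=> a x h x' h' xh xh'; have := rep_linear H a xh xh'; congr (hrep _ _).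
  rewrite -linearP; apply: (congr1 (dual_pair D' _ _)); congr (_, _).
  by rewrite /= scaler0 addr0.
- move=> w bw; apply: (rep_total H); rewrite [LHS]cyc bw oppr0.
  exact: linear0.
- move=> w h /(rep_cycle H); rewrite [LHS]cyc.
  by move=> /dual_pair_eq0/eqP; rewrite oppr_eq0 => /eqP.
- move=> h; have [z zh] := rep_surj H h.
  have [[x w] xw] := @dual_pair_surj _ _ D' _ _ z.
  by exists w; rewrite -(dual_top0 x) xw.
- move=> w h /(rep0P H) ->; split=> [[u uE]|[[p v]]].
    have [[x v] xv] := @dual_pair_surj _ _ D' _ _ u.
    have [p pE] := t0S x; move: uE; rewrite -xv -pE [LHS]cone_cocycle.
    by move=> /dual_pair_inj[<-]; exists (p, v); rewrite EE.
  rewrite EE /= => <-; exists (dual_pair D' _ _ (t0 p, v)).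
  exact: cone_cocycle.
Qed.

Lemma Ext_sequence :
  exists (f : {linear Ext_pred D' Q n -> Ext D' cone_resolution n.+1})
         (g : {linear Ext D' cone_resolution n.+1 -> M})
         (sigma : {linear M -> Ext D' Q n})
         (h : {linear Ext D' Q n -> Ext D' cone_resolution n.+2}),
    [/\ injective f, exact_at f g, exact_at g sigma, exact_at sigma h & surj h] /\
    forall x, hrep (dual_map D' (phi n) (t0 x)) (sigma (res_aug P x)).
Proof.
have [rep1 h1] := shiftQ_homology_pred n.
have [F FE] : exists F : {linear (P 1 * dual D' (shiftQ n))%type ->
    (P 0 * dual D' (shiftQ n.+1))%type},
    forall y, F y = (res_diff P 0 y.1, c1 y.1 - b0 y.2).
  have [p pE] := @linear_of_fun _ (P 1 * dual D' (shiftQ n))%type (P 1) fst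
    (fun _ _ _ => erefl).
  have [l lE] := linear_pair c1 (\- b0).
  have [F FE] := linear_topair (res_diff P 0 \o p) l.
  by exists F => y; rewrite FE lE /= pE.
have [E EE] : exists E : {linear (P 0 * dual D' (shiftQ n.+1))%type ->
    dual D' (shiftQ n.+2)}, forall x, E x = c0 x.1 - b1 x.2.
  exact: (linear_pair c0 (\- b1)).
apply: (cone_sequence (@res_diff_exact _ _ P 0) (res_aug_exact P) _ _ _ FE EE h1
  (shiftQ_homology n) (cone_homology1 FE EE) (cone_homology2 EE)).
- move=> x; apply: dualP => z; rewrite /b2 /c0.
  rewrite -[LHS]/(dual_eval (t0 x) (phi n (res_diff Q n z))) -phi_chain.
  by rewrite (@dual_rev_zero n (phi n.+1 z)) linear0 !dual_eval0.
- move=> y; rewrite -[LHS]/(dual_map D' (shift_phi n.+1) (t0 (res_diff P 0 y))) -t1d.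
  by apply: dualP => z; rewrite !dual_eval_map shift_phi_chain.
- exact: t1dd.
Qed.

End Sequence.
End Cone.

(** This supplies the condition on [d2] in the cone sequence. For n > 0 the preimage is the dual of
    [phi] applied to the evaluation of z, by the chain relation; for n = 0 the target is zero. *)
Lemma top_eval_boundary (A B : pzRingType) (D : bimodule A B) (D' : bimodule B A)
    (M : lmodType A) (P : proj_resolution M) n (Q : proj_resolution (Ext D P n))
    (phi : forall i, {linear Q i -> dual_rev D P n i})
    (t1 : {linear P 1 -> dual D' (dual_rev D P n.+1 n)})
    (t2 : {linear P 2 -> dual D' (dual_rev D P n.+2 n)}) z :
  (forall i x, rev_diff D P n i (phi i.+1 x) = phi i (res_diff Q i x)) ->
  (forall x, hrep (phi 0 x : dual D (P n)) (res_aug Q x)) ->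
  (forall z, dual_map D' (rev_diff D P n.+2 n) (t2 z) = t1 (res_diff P 1 z)) ->
  exists v, dual_map D' (shiftQ_diff Q n) v =
    dual_map D' (shift_phi phi n) (t1 (res_diff P 1 z)).
Proof.
case: n Q phi t1 t2 => [|m] Q phi t1 t2 phic phi0 t2d.
  exists 0; rewrite linear0; apply/esym.
  by apply: dual_zero_module; apply: zero_rV0.
exists (dual_map D' (shift_phi phi m) (t2 z)); apply: dualP => y.
rewrite -t2d !dual_eval_map; congr (dual_eval _ _).
by rewrite -(shift_phi_chain phic phi0).
Qed.

(** * The grade sequence *)

Lemma grade_sequence (A B : pzRingType) (D : bimodule A B) (D' : bimodule B A)
    (du : duality D D') (M : lmodType A) (P : proj_resolution M) n
    (Q : proj_resolution (Ext D P n)) (N : lmodType B)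
    (q : {linear dual D (P n.+1) -> N}) :
  fg_resolution P -> (forall j, (j < n)%N -> is_zero_module (Ext D P j)) ->
  right_exact (dual_map D (res_diff P n)) q ->
  exists (R : proj_resolution N)
         (f : {linear Ext_pred D' Q n -> Ext D' R n.+1}) (g : {linear Ext D' R n.+1 -> M})
         (sigma : {linear M -> Ext D' Q n}) (h : {linear Ext D' Q n -> Ext D' R n.+2}),
    [/\ injective f, exact_at f g, exact_at g sigma, exact_at sigma h & surj h].
Proof.
move=> Pfg van dq.
have [phi [phic phi0]] := lift_to_cocycles Q van.
have [t0 [t1 [t2 [t0I t0S t1S t1d t2d]]]] := top_eval du Pfg n.
have t1dd z := top_eval_boundary z phic phi0 t2d.
exists (cone_resolution du Pfg phic phi0 van dq).
have [f [g [s [h [E _]]]]] := Ext_sequence du Pfg phic phi0 van dq t0I t0S t1S t1d t1dd.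
by exists f, g, s, h.
Qed.

Section FiveTerms.
Variables (A : pzRingType) (H1 K1 M H2 K2 : lmodType A).
Variables (f : {linear H1 -> K1}) (g : {linear K1 -> M}) (s : {linear M -> H2})
  (h : {linear H2 -> K2}).
Hypotheses (fI : injective f) (fg : exact_at f g) (gs : exact_at g s)
  (sh : exact_at s h) (hS : surj h).

Lemma five_terms_left : is_zero_module K1 <-> is_zero_module H1 /\ injective s.
Proof.
split=> [K10|[H10 sI] k].
  split=> [x|]; first by apply: fI; rewrite linear0 [LHS]K10.
  by apply: linear_inj => m /gs[k <-]; rewrite (K10 k) linear0.
have gk : g k = 0 by apply: sI; rewrite linear0; apply/gs; exists k.
by have [x <-] := (fg k).1 gk; rewrite (H10 x) linear0.
Qed.

Lemma five_terms_right : is_zero_module K2 <-> surj s.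
Proof.
split=> [K20 v|sS k]; first by apply/sh.
by have [v <-] := hS k; apply/sh.
Qed.

End FiveTerms.

(** * The case n = 0: sigma is evaluation into the bidual *)

Section Evaluation0.
Variables (A B : pzRingType) (D : bimodule A B) (D' : bimodule B A).
Variable du : duality D D'.
Variables (X : lmodType A) (P : proj_resolution X) (Q : proj_resolution (Ext D P 0)).
Variable phi : {linear Q 0 -> dual D (P 0)}.
Hypothesis phi_aug : forall y, hrep (phi y) (res_aug Q y).
Variable sigma : {linear X -> Ext D' Q 0}.
Hypothesis sigmaE : forall p,
  hrep (dual_map D' phi (ev du (P 0) p)) (sigma (res_aug P p)).

Let HP := hrepP (codiff D P 0) (codiff D P 1).
Let HQ := hrepP (codiff D' Q 0) (codiff D' Q 1).
Let eS : surj (res_aug P) := (res_aug_exact P).2.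

Lemma rep_eq0P y : res_aug Q y = 0 <-> phi y = 0.
Proof. by rewrite (rep0P HP (phi_aug y)); split=> [[u <-]|->] //; exists 0. Qed.

Lemma cocycle_of_dual y : exists f, dual_map D (res_aug P) f = phi y.
Proof.
have := rep_cycle HP (phi_aug y) => cyc.
have [x|f fE] := factor_surj (f := phi y : {linear P 0 -> D}) eS.
  move=> /(res_aug_exact P).1[x1 <-].
  exact: (congr1 (fun z => dual_eval z x1) cyc).
by exists f; apply: dualP.
Qed.

Lemma dual_of_cocycle f : exists y, phi y = dual_map D (res_aug P) f.
Proof.
have [|h hE] := rep_total HP (v := dual_map D (res_aug P) f).
  by apply: dual_map_comp0 => x; apply: res_aug0.
have [y yE] := (res_aug_exact Q).2 h; exists y.
have r := rep_linear HP (-1) (phi_aug y) hE.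
have r0 : -1 *: res_aug Q y + h = 0 by rewrite yE scaleN1r addNr.
have [u uE] := (rep0P HP r).1 r0.
by apply/esym/eqP; rewrite -subr_eq0 addrC -scaleN1r -uE.
Qed.

Lemma dual_aug_inj f : dual_map D (res_aug P) f = 0 -> f = 0.
Proof.
move=> e; apply: dualP => x; have [p <-] := eS x.
exact: (congr1 (fun z => dual_eval z p) e).
Qed.

(** Degree-0 cocycles on [P] are exactly the forms on [X] pulled back along the augmentation, and
    [phi] maps onto them. So y |-> ev p (phi y) vanishes exactly when every form on [X] vanishes at
    the image of p. *)
Lemma sigma_inj : injective sigma <-> injective (ev du X).
Proof.
have key p : sigma (res_aug P p) = 0 <-> ev du X (res_aug P p) = 0.
  rewrite (rep0P HQ (sigmaE p)); split=> [[u /esym uE]|e].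
    apply: dualP => f; have [y yE] := dual_of_cocycle f.
    have := congr1 (fun z => dual_eval z y) uE.
    by rewrite dual_eval_map !evE yE dual_eval_map.
  exists 0; rewrite linear0; apply: dualP => y.
  have [f fE] := cocycle_of_dual y.
  have := congr1 (fun z => dual_eval z f) e.
  by rewrite dual_eval_map !evE -fE dual_eval_map => ->.
split=> sI; apply: linear_inj => x; have [p <-] := eS x.
  by move=> /key e; apply: sI; rewrite e linear0.
by move=> /key e; apply: sI; rewrite e linear0.
Qed.

(** Forms F on X^* correspond to cocycles w on [Q 0] by w y = F f whenever phi y is the pullback of
    f. Coboundaries in degree 0 vanish, so a class is its cocycle. *)
Lemma sigma_surj : surj sigma <-> surj (ev du X).
Proof.
split=> sS.
  move=> F; have [|||w wE] := @linear_of_rel _ (Q 0) D'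
    (fun y v => exists2 f, dual_map D (res_aug P) f = phi y & dual_eval F f = v).
  - move=> a y v y' v' [f fE <-] [f' fE' <-]; exists (a *: f + f').
      by rewrite [LHS]linearP [RHS]linearP -fE -fE'.
    exact: dual_eval_lin.
  - by move=> y; have [f fE] := cocycle_of_dual y; exists (dual_eval F f), f.
  - by move=> v [f]; rewrite linear0 => /dual_aug_inj -> <-; apply: dual_eval0.
  have [|h hE] := rep_total HQ (v := (w : dual D' (Q 0))).
    apply: dualP => y; apply/wE; exists 0; last exact: dual_eval0.
    by rewrite linear0; apply/esym/rep_eq0P/res_aug0.
  have [x xE] := sS h; have [p pE] := eS x; exists x; apply: dualP => f.
  have r := rep_linear HQ (-1) (sigmaE p) hE.
  have r0 : -1 *: sigma (res_aug P p) + h = 0 by rewrite pE xE scaleN1r addNr.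
  have [u uE] := (rep0P HQ r).1 r0.
  have {uE}uE : dual_map D' phi (ev du (P 0) p) = w.
    by apply/esym/eqP; rewrite -subr_eq0 addrC -scaleN1r -uE.
  have [y yE] := dual_of_cocycle f.
  have -> : dual_eval F f = dual_eval (w : dual D' (Q 0)) y.
    by apply/esym/wE; exists f.
  by rewrite -uE dual_eval_map !evE yE dual_eval_map pE.
move=> h; have [w wh] := rep_surj HQ h.
have [|||F FE] := @linear_of_rel _ (dual D X) D'
  (fun f v => exists2 y, phi y = dual_map D (res_aug P) f & dual_eval w y = v).
- move=> a f v f' v' [y yE <-] [y' yE' <-]; exists (a *: y + y').
    by rewrite [LHS]linearP [RHS]linearP yE yE'.
  exact: dual_eval_lin.
- by move=> f; have [y yE] := dual_of_cocycle f; exists (dual_eval w y), y.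
- move=> v [y]; rewrite linear0 => /rep_eq0P/(res_aug_exact Q).1[y1 <-] <-.
  exact: (congr1 (fun z => dual_eval z y1) (rep_cycle HQ wh)).
have [x xE] := sS F; have [p pE] := eS x; exists x; rewrite -pE.
apply: (rep_eq HQ (sigmaE p) wh); exists 0; rewrite linear0.
apply/esym/eqP; rewrite subr_eq0; apply/eqP/dualP => y.
have [f fE] := cocycle_of_dual y.
have -> : dual_eval w y = dual_eval (F : dual D' (dual D X)) f.
  by apply/esym/FE; exists y.
by rewrite -xE dual_eval_map !evE -fE dual_eval_map pE.
Qed.

End Evaluation0.

Lemma fg_homology (A : pzRingType) (U V W : lmodType A) (f : {linear U -> V})
    (g : {linear V -> W}) :
  left_noetherian A -> finitely_generated V -> finitely_generated (homology f g).
Proof.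
move=> noeA Vfg; have [c cE] := homology_class f g.
apply: fg_surj (homology_class_surj cE) _.
exact: fg_inj noeA _ _ _ (@ker_inc_inj _ _ _ g) Vfg.
Qed.

(** The sequence for n = 0 starts with Ext^(-1) = 0, so Ext^1 and Ext^2 of the transpose are the
    kernel and cokernel of sigma, which is injective or surjective exactly when evaluation is. *)
Lemma transpose_Ext (A B : pzRingType) (D : bimodule A B) (D' : bimodule B A)
    (du : duality D D') (X : lmodType A) (T : lmodType B) (Res : proj_resolution T) :
  left_noetherian A -> left_noetherian B -> is_transpose D X T ->
  (injective (ev du X) <-> is_zero_module (Ext D' Res 1)) /\
  (surj (ev du X) <-> is_zero_module (Ext D' Res 2)).
Proof.
move=> noeA noeB XT.
have Xfg : finitely_generated X.
  by case: XT => [P1 [P0 [d [e [q [_ [P0f _] [_ eS] _]]]]]]; apply: fg_surj eS P0f.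
have [P Pfg] := fg_resolution_exists noeA Xfg.
have [N [q dq]] := cokernel_exists (dual_map D (res_diff P 0)).
have XN : is_transpose D X N.
  exists (P 1), (P 0), (res_diff P 0), (res_aug P), q; split=> //.
  exact: res_aug_exact.
(* [T] may come from another presentation of [X]; Ext in positive degree does not see the
   difference. *)
have TN := transpose_stable du (stably_iso_refl X) XT XN.
have [Q _] : exists Q : proj_resolution (Ext D P 0), fg_resolution Q.
  apply: fg_resolution_exists => //; apply: fg_homology => //.
  exact: (fg_projective_dual du (Pfg 0%N)).1.
have van j : (j < 0)%N -> is_zero_module (Ext D P j) by [].
have [phi [phic phi0]] := lift_to_cocycles Q van.
have [t1d t2d] := (ev_natural du (res_diff P 0), ev_natural du (res_diff P 1)).
have t1dd z := @top_eval_boundary _ _ D D' _ P 0 Q phi (ev du (P 1)) (ev du (P 2))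
  z phic phi0 t2d.
have [f [g [s [h [[fI fg gs sh hS] sE]]]]] := @Ext_sequence _ _ D D' du _ P Pfg 0 Q phi
  phic phi0 van N q dq (ev du (P 0)) (ev du (P 1)) (ev_inj (Pfg 0%N))
  (ev_surj du (Pfg 0%N)) (ev_surj du (Pfg 1%N)) t1d t1dd.
set R := cone_resolution _ _ _ _ _ _ in f g h fI fg gs sh hS.
have i1 := Ext_stable_iso D' Res R 0 TN.
have i2 := Ext_stable_iso D' Res R 1 TN.
rewrite -(sigma_inj phi0 sE) -(sigma_surj phi0 sE); split.
  split=> [sI|/(miso_zero i1)/(five_terms_left fI fg gs)[]] //.
  apply: miso_zero (miso_sym i1) _; apply/(five_terms_left fI fg gs).
  by split=> //; apply: zero_rV0.
rewrite -(five_terms_right sh hS); split; apply: miso_zero => //.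
exact: miso_sym.
Qed.

Definition regular_duality (L : pzRingType) :
    duality (right_regular L) (left_regular L) :=
  @Duality L^c L (right_regular L) (left_regular L) id id
    (fun _ => erefl) (fun _ => erefl) (fun _ _ => erefl) (fun _ _ => erefl)
    (fun _ _ => erefl) (1 : L) id id (@mul1r L) (@mul1r L) (@mulr1 L) (@mulr1 L).

Definition regular_duality_op (L : pzRingType) :
    duality (left_regular L) (right_regular L) :=
  @Duality L L^c (left_regular L) (right_regular L) id id
    (fun _ => erefl) (fun _ => erefl) (fun _ _ => erefl) (fun _ _ => erefl)
    (fun _ _ => erefl) (1 : L) id id (@mulr1 L) (@mulr1 L) (@mul1r L) (@mul1r L).

Section Torsionfree.
Variables (L : pzRingType) (X : lmodType L^c).

Lemma bidual_mapE x : bidual_map (right_regular L) x = ev (regular_duality L) X x.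
Proof. by apply: dualP => f; rewrite evE. Qed.

Lemma torsionfreeE :
  torsionfree (right_regular L) X <-> injective (ev (regular_duality L) X).
Proof.
by split=> I x y; [rewrite -!bidual_mapE|rewrite !bidual_mapE]; apply: I.
Qed.

Lemma reflexiveE : reflexive_module (right_regular L) X <->
  injective (ev (regular_duality L) X) /\ surj (ev (regular_duality L) X).
Proof.
split=> [bij|[I S]].
  split; first exact/torsionfreeE/bij_inj.
  by case: bij => g _ gK F; exists (g F); rewrite -bidual_mapE gK.
by apply: eq_bij (inj_surj_bij I S) _ _ => x; rewrite bidual_mapE.
Qed.

End Torsionfree.

(* [P], [Q] and [Res] are the projective resolutions used to compute Ext of [M],
   of [Ext (right_regular L) P n] and of [T], where [X] represents
   Sigma^n Omega^n M and [T] represents Tr X. *)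
Theorem proposition2p19 (L : pzRingType)
    (noethL : noetherian L) (spL : semiperfect L)
    (M : lmodType L^c) (fpM : finitely_presented M) (n : nat)
    (P : proj_resolution M) (gradeM : grade_eq (right_regular L) P n)
    (Q : proj_resolution (Ext (right_regular L) P n))
    (X : lmodType L^c) (XE : is_sigma_omega (right_regular L) n M X)
    (T : lmodType L) (TE : is_transpose (right_regular L) X T)
    (Res : proj_resolution T) :
  exists (f : {linear Ext_pred (left_regular L) Q n -> Ext (left_regular L) Res 1})
         (g : {linear Ext (left_regular L) Res 1 -> M})
         (sigma : {linear M -> Ext (left_regular L) Q n})
         (h : {linear Ext (left_regular L) Q n -> Ext (left_regular L) Res 2}),
    [/\ injective f, exact_at f g, exact_at g sigma, exact_at sigma h & surj h]
    /\ (torsionfree (right_regular L) X <->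
          is_zero_module (Ext_pred (left_regular L) Q n) /\ injective sigma)
    /\ (reflexive_module (right_regular L) X <->
          is_zero_module (Ext_pred (left_regular L) Q n) /\ bijective sigma).
Proof.
pose D := right_regular L; pose D' := left_regular L.
pose du : duality D D' := regular_duality L.
have [noeB noeA] := noethL.
have Mfg : finitely_generated M.
  by have [m [k [_ [f [_ fS]]]]] := fpM; exists k, f.
have [P' P'fg] := fg_resolution_exists noeA Mfg.
have van j : (j < n)%N -> is_zero_module (Ext D P' j).
  move=> jn; apply: miso_zero (Ext_resolution_iso D P P' j) _.
  by apply: contrapT => /gradeM.2; rewrite leqNgt jn.
have [N [q dq]] := cokernel_exists (dual_map D (res_diff P' n)).
have K0N : is_transpose D (syzygy_of P' n) N.
  have [a aE] := syzygy_presentation P' n.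
  by exists (P' n.+1), (P' n), (res_diff P' n), a, q; split.
have Nfg : finitely_generated N.
  exact: fg_surj dq.2 (fg_projective_dual du (P'fg n.+1)).1.
have [S Sfg] := fg_resolution_exists noeB Nfg.
have [K [Z [MK KZ ZX]]] := XE.
have KK0 := syzygy_iter_stable MK (syzygy_iter n P'fg).
have TS := sigma_syzygy du (regular_duality_op L) K0N KK0 Sfg KZ ZX TE.
have [th [th' [thK thK']]] := Ext_resolution_iso D P P' n.
(* [Q] resolves Ext^n computed from [P], not from [P']. Changing only its augmentation leaves Ext of
   [Q] unchanged up to conversion. *)
have Q'aug : right_exact (res_diff Q 0) (th \o res_aug Q).
  have [dE eS] := res_aug_exact Q; split=> [x|v] /=.
    rewrite -dE -{1}(linear0 th); split=> [/(can_inj thK)|->] //.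
  by have [x xE] := eS (th' v); exists x; rewrite xE thK'.
pose Q' := ProjResolution (@res_projective _ _ Q) Q'aug (@res_diff_exact _ _ Q).
have [R [f [g [s [h [fI fg gs sh hS]]]]]] := grade_sequence du Q' P'fg van dq.
(* [T] is stably Omega^n of [N], whose Ext^1 and Ext^2 are those of [N] in degrees n.+1 and n.+2;
   there [S] is exchanged for the cone resolution [R]. *)
have [S' [S1 S2]] := Ext_shift S D' n.
have [a [a' [aK a'K]]] : miso (Ext D' Res 1) (Ext D' R n.+1).
  apply: miso_trans (Ext_stable_iso D' Res S' 0 TS) _; rewrite S1.
  exact: Ext_resolution_iso.
have [b [b' [bK b'K]]] : miso (Ext D' Res 2) (Ext D' R n.+2).
  apply: miso_trans (Ext_stable_iso D' Res S' 1 TS) _; rewrite S2.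
  exact: Ext_resolution_iso.
have aI := can_inj a'K; have bI := can_inj b'K.
have fI' : injective (a' \o f) := inj_comp aI fI.
have fg' : exact_at (a' \o f) (g \o a).
  by move=> k /=; rewrite fg; split=> -[x xE]; exists x; rewrite /= ?xE ?aK // -xE a'K.
have gs' : exact_at (g \o a) s.
  by move=> m; rewrite gs; split=> -[x <-]; [exists (a' x); rewrite /= a'K|exists (a x)].
have sh' : exact_at s (b' \o h).
  by move=> v; rewrite -sh /= -{1}(linear0 b'); split=> [/bI|->].
have hS' : surj (b' \o h).
  by move=> k; have [v vE] := hS (b k); exists v; rewrite /= vE bK.
(* The same Ext^1 and Ext^2 of [T] measure both the defect of evaluation on [X] and the outer terms
   around sigma; their vanishing links the two. *)
have [tf rf] := transpose_Ext du Res noeA noeB TE.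
have lft := five_terms_left fI' fg' gs'.
have rgt := five_terms_right sh' hS'.
exists (a' \o f), (g \o a), s, (b' \o h); split=> //; split.
  by rewrite torsionfreeE tf lft.
rewrite reflexiveE tf rf lft rgt; split=> [[[? ?] ?]|[? sB]].
  by split=> //; apply: inj_surj_bij.
split; first by split=> //; apply: bij_inj.
by case: sB => k _ kK v; exists (k v); rewrite kK.
Qed.
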